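(* Let $H$ be a group, let $\phi\in\operatorname{Aut}(H)$ and let $K$ be a proper subgroup of $H$ such that $K$ is a proper subgroup of its normalizer $N_H(K)$. Let $G=H\ast_{(K,\phi)}=\langle H, t;\ tkt^{-1}=\phi(k),\ k\in K\rangle$. Suppose that $G$ is hyperbolic and not residually finite. Then $K$ is finite, and $H$ is hyperbolic and not residually finite.
   Context: For a group $H$, $\phi\in\operatorname{Aut}(H)$ and a proper subgroup $K\lneq H$, the automorphism-induced HNN-extension $H\ast_{(K,\phi)}$ is the group given by the relative presentation $\langle H, t;\ tkt^{-1}=\phi(k),\ k\in K\rangle$. Hyperbolic means word-hyperbolic in the sense of Gromov (in particular finitely generated). *)

(* Defs.v *)
From Stdlib Require Import List.
Import ListNotations.
Set Implicit Arguments.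

(** Abstract groups (left-axiom presentation, which implies the group axioms). *)
Record Group := {
  gcar :> Type;
  gmul : gcar -> gcar -> gcar;
  gone : gcar;
  ginv : gcar -> gcar;
  gassoc : forall x y z, gmul x (gmul y z) = gmul (gmul x y) z;
  gone_l : forall x, gmul gone x = x;
  ginv_l : forall x, gmul (ginv x) x = gone }.

Arguments gmul {g}.
Arguments gone {g}.
Arguments ginv {g}.

Definition is_hom {G L : Group} (f : G -> L) : Prop :=
  forall x y : G, f (gmul x y) = gmul (f x) (f y).

Definition is_aut {H : Group} (phi : H -> H) : Prop :=
  is_hom phi /\ (forall x y, phi x = phi y -> x = y) /\ (forall y, exists x, phi x = y).

Definition is_subgroup {H : Group} (K : H -> Prop) : Prop :=
  K gone /\ (forall x y, K x -> K y -> K (gmul x y)) /\ (forall x, K x -> K (ginv x)).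

Definition proper_subset {H : Group} (K : H -> Prop) : Prop := exists h, ~ K h.

Definition in_normalizer {H : Group} (K : H -> Prop) (g : H) : Prop :=
  forall k, K k <-> K (gmul (gmul g k) (ginv g)).

(** K is a proper subgroup of N_H(K) (K <= N_H(K) always holds). *)
Definition proper_in_normalizer {H : Group} (K : H -> Prop) : Prop :=
  exists g, in_normalizer K g /\ ~ K g.

Definition finite_subset {H : Group} (K : H -> Prop) : Prop :=
  exists l : list H, forall k, K k -> In k l.

Definition finite_group (F : Group) : Prop := exists l : list F, forall x : F, In x l.

Definition is_HNN {H : Group} (K : H -> Prop) (phi : H -> H)
    {G : Group} (i : H -> G) (t : G) : Prop :=
  is_hom i /\
  (forall k, K k -> gmul (gmul t (i k)) (ginv t) = i (phi k)) /\
  (forall (L : Group) (f : H -> L) (s : L),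
     is_hom f ->
     (forall k, K k -> gmul (gmul s (f k)) (ginv s) = f (phi k)) ->
     exists F : G -> L,
       is_hom F /\ (forall h, F (i h) = f h) /\ F t = s /\
       (forall F' : G -> L, is_hom F' -> (forall h, F' (i h) = f h) -> F' t = s ->
          forall x, F' x = F x)).

Definition residually_finite (G : Group) : Prop :=
  forall g : G, g <> gone ->
    exists (F : Group) (f : G -> F), finite_group F /\ is_hom f /\ f g <> gone.

Definition adj {G : Group} (S : list G) (x y : G) : Prop :=
  exists s, In s S /\ (y = gmul x s \/ y = gmul x (ginv s)).

(** [x :: p] is an edge path in the Cayley graph from x to [last p x]. *)
Fixpoint is_path {G : Group} (S : list G) (x : G) (p : list G) : Prop :=
  match p with
  | [] => True
  | y :: q => adj S x y /\ is_path S y q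
  end.

(** A geodesic from x to y: an edge path of minimal length (length p = #edges). *)
Definition geodesic {G : Group} (S : list G) (x : G) (p : list G) (y : G) : Prop :=
  is_path S x p /\ last p x = y /\
  forall q, is_path S x q -> last q x = y -> length p <= length q.

Definition dist_le {G : Group} (S : list G) (x y : G) (n : nat) : Prop :=
  exists p, is_path S x p /\ last p x = y /\ length p <= n.

Definition generates {G : Group} (S : list G) : Prop :=
  forall x : G, exists p, is_path S gone p /\ last p gone = x.

(** Word-hyperbolic: finitely generated, with delta-slim geodesic triangles
    in the Cayley graph (vertex version). *)
Definition hyperbolic (G : Group) : Prop :=
  exists (S : list G) (delta : nat), generates S /\
    forall (x y z : G) (p q r : list G),
      geodesic S x p y -> geodesic S y q z -> geodesic S z r x ->
      forall v, In v (x :: p) ->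
        exists w, (In w (y :: q) \/ In w (z :: r)) /\ dist_le S v w delta.

(* Main.v *)
(** Let [g] normalize [K], [g] not in [K].  Then [c = t^-1 phi(g) t g^-1] centralizes [K], and
    [k c^p] determines [k] and [p].  In a hyperbolic group an element commuting with [c] translates
    a long geodesic from [1] to [c^n] approximately along itself, so counting the elements [k c^p]
    forces [K] to be finite.

    No normal form theorem is needed for [G]: because [phi] is an automorphism, [t] may act on
    [H * J] by [(y, j) => (phi y, sigma_(K y) j)], for any permutations [sigma] of [J] indexed by
    the cosets [K y], with [H] acting by left translation of the first factor.  Taking for [J] a
    bouquet of lines, this action shows that [c] has infinite order, and it yields a map [G -> H]
    which is the identity on [H] and, when [K] is finite, sends adjacent elements to elements
    differing by a finite set.  Hence [H] is finitely generated and undistorted in [G], so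
    hyperbolic by stability of quasi-geodesics.

    If moreover [H] were residually finite, replace [H] in this action by a finite set of functions
    [Hom(H, F) -> F], with [F] a finite quotient of [H] separating enough elements from [K], and
    [J] by a finite set: the free-group argument for residual finiteness then shows that [G] is
    residually finite. *)

From Stdlib Require Import List Arith Lia Bool Classical ClassicalEpsilon
  FunctionalExtensionality PropExtensionality ProofIrrelevance.
Import ListNotations.
Require Import Defs.

(** * Groups, permutations and actions of HNN extensions *)

Lemma gcancel_l {G : Group} (a x y : G) : gmul a x = gmul a y -> x = y.
Proof.
  intros E. rewrite <- (gone_l _ x), <- (gone_l _ y), <- (ginv_l _ a), <- !gassoc, E.
  reflexivity.
Qed.

Lemma ginv_r {G : Group} (x : G) : gmul x (ginv x) = gone.
Proof.
  apply (gcancel_l (ginv x)). rewrite gassoc, ginv_l, gone_l.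
  apply (gcancel_l (ginv (ginv x))). rewrite gassoc, ginv_l, gone_l. reflexivity.
Qed.

Lemma gone_r {G : Group} (x : G) : gmul x gone = x.
Proof. rewrite <- (ginv_l _ x), gassoc, ginv_r, gone_l. reflexivity. Qed.

Lemma gmulK {G : Group} (x y : G) : gmul (gmul x y) (ginv y) = x.
Proof. now rewrite <- gassoc, ginv_r, gone_r. Qed.

Lemma gmulVK {G : Group} (x y : G) : gmul (gmul x (ginv y)) y = x.
Proof. now rewrite <- gassoc, ginv_l, gone_r. Qed.

Lemma ginv_unique {G : Group} (x y : G) : gmul x y = gone -> y = ginv x.
Proof. intros E. apply (gcancel_l x). now rewrite E, ginv_r. Qed.

Lemma ginv_inv {G : Group} (x : G) : ginv (ginv x) = x.
Proof. symmetry. apply ginv_unique, ginv_l. Qed.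

Lemma ginv_mul {G : Group} (x y : G) : ginv (gmul x y) = gmul (ginv y) (ginv x).
Proof. symmetry. apply ginv_unique. now rewrite gassoc, gmulK, ginv_r. Qed.

Lemma ginv_one {G : Group} : ginv (@gone G) = gone.
Proof. symmetry. apply ginv_unique, gone_l. Qed.

Ltac grp := rewrite ?ginv_mul, ?ginv_inv, ?ginv_one, ?gassoc;
  repeat (rewrite ?gone_l, ?gone_r, ?ginv_l, ?ginv_r, ?gmulK, ?gmulVK); try reflexivity.

Lemma gcancel_r {G : Group} (a x y : G) : gmul x a = gmul y a -> x = y.
Proof. intros E. rewrite <- (gmulK x a), E. grp. Qed.

Lemma hom_one {G L : Group} (f : G -> L) : is_hom f -> f gone = gone.
Proof. intros Hf. apply (gcancel_l (f gone)). rewrite <- Hf. grp. Qed.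

Lemma hom_inv {G L : Group} (f : G -> L) (x : G) : is_hom f -> f (ginv x) = ginv (f x).
Proof. intros Hf. apply ginv_unique. rewrite <- Hf. grp. now apply hom_one. Qed.

Lemma aut_inverse {H : Group} (phi : H -> H) : is_aut phi ->
  exists psi, is_hom psi /\ (forall x, psi (phi x) = x) /\ (forall x, phi (psi x) = x).
Proof.
  intros [Hh [Hi Hs]].
  set (psi := fun y => proj1_sig (constructive_indefinite_description _ (Hs y))).
  assert (E : forall x, phi (psi x) = x)
    by (intros x; exact (proj2_sig (constructive_indefinite_description _ (Hs x)))).
  exists psi. repeat split; auto.
  intros x y. apply Hi. now rewrite Hh, !E.
Qed.

Record perm (X : Type) := Perm {
  pfun :> X -> X;
  pinv : X -> X;
  pfunK : forall x, pinv (pfun x) = x;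
  pinvK : forall x, pfun (pinv x) = x }.
Arguments pfun {X}. Arguments pinv {X}. Arguments pfunK {X}. Arguments pinvK {X}.

Lemma perm_ext {X : Type} (p q : perm X) : (forall x, p x = q x) -> p = q.
Proof.
  destruct p as [f f' a b], q as [g g' c d]; simpl. intros E.
  assert (f = g) by now apply functional_extensionality. subst g.
  assert (f' = g'). { apply functional_extensionality. intros x. now rewrite <- (d x), a, c. }
  subst g'. f_equal; apply proof_irrelevance.
Qed.

Definition pid (X : Type) : perm X :=
  Perm X (fun x => x) (fun x => x) (fun x => eq_refl) (fun x => eq_refl).

Definition pinverse {X : Type} (p : perm X) : perm X :=
  Perm X (pinv p) (pfun p) (pinvK p) (pfunK p).

Definition pcomp {X : Type} (p q : perm X) : perm X.
Proof.
  refine (Perm X (fun x => p (q x)) (fun x => pinv q (pinv p x)) _ _).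
  - intros x. now rewrite pfunK, pfunK.
  - intros x. now rewrite pinvK, pinvK.
Defined.

Definition Sym (X : Type) : Group.
Proof.
  refine {| gcar := perm X; gmul := pcomp; gone := pid X; ginv := pinverse |}.
  - intros p q r. now apply perm_ext.
  - intros p. now apply perm_ext.
  - intros p. apply perm_ext. intros x. simpl. apply pfunK.
Defined.

Definition skew {X J : Type} (tau : perm X) (sigma : X -> perm J) : perm (X * J).
Proof.
  refine (Perm (X * J) (fun z => (tau (fst z), sigma (fst z) (snd z)))
    (fun z => (pinv tau (fst z), pinv (sigma (pinv tau (fst z))) (snd z))) _ _).
  - intros [x j]; simpl. now rewrite !pfunK.
  - intros [x j]; simpl. now rewrite !pinvK.
Defined.

(** On the first factor [t k t^-1] acts as [phi k] because [tau] intertwines the two. On the second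
    factor [t] applies [sigma] at [k x] and [t^-1] undoes [sigma] at [x]; these cancel since [sigma]
    is constant on [K]-orbits. *)
Lemma HNN_skew {H : Group} {K : H -> Prop} {phi : H -> H} {G : Group} {i : H -> G} {t : G}
    {X J : Type} (act : H -> X -> X) (tau : perm X) (sigma : X -> perm J) :
  is_HNN K phi i t ->
  (forall x, act gone x = x) ->
  (forall g h x, act (gmul g h) x = act g (act h x)) ->
  (forall k x, K k -> tau (act k x) = act (phi k) (tau x)) ->
  (forall k x, K k -> sigma (act k x) = sigma x) ->
  exists F : G -> Sym (X * J), is_hom F /\
    (forall h x j, pfun (F (i h)) (x, j) = (act h x, j)) /\
    (forall x j, pfun (F t) (x, j) = (tau x, sigma x j)) /\
    (forall x j, pfun (F (ginv t)) (x, j)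
       = (pinv tau x, pinv (sigma (pinv tau x)) j)).
Proof.
  intros [_ [_ U]] A1 AM Ht Hs.
  assert (AI : forall h x, act (ginv h) (act h x) = x)
    by (intros; rewrite <- AM; grp; apply A1).
  assert (AI' : forall h x, act h (act (ginv h) x) = x)
    by (intros; rewrite <- AM; grp; apply A1).
  set (f := fun h : H => Perm (X * J) (fun z => (act h (fst z), snd z))
    (fun z => (act (ginv h) (fst z), snd z))
    (fun z => match z with (x, j) => f_equal (fun y => (y, j)) (AI h x) end)
    (fun z => match z with (x, j) => f_equal (fun y => (y, j)) (AI' h x) end)).
  destruct (U (Sym (X * J)) f (skew tau sigma)) as [F [Fh [Fi [Ft _]]]].
  - intros g h. apply perm_ext. intros [x j]. simpl. now rewrite AM.
  - intros k Hk. apply perm_ext. intros [x j]. simpl.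
    rewrite Ht, Hs, !pinvK; auto.
  - exists F. split; [exact Fh|]. split; [|split].
    + intros. now rewrite Fi.
    + intros. now rewrite Ft.
    + intros. rewrite (hom_inv F t Fh), Ft. reflexivity.
Qed.

Definition sub_group {G : Group} (P : G -> Prop) (P1 : P gone)
    (PM : forall x y, P x -> P y -> P (gmul x y)) (PV : forall x, P x -> P (ginv x)) : Group.
Proof.
  refine {| gcar := {x : G | P x};
    gmul := fun x y => exist _ (gmul (proj1_sig x) (proj1_sig y))
                         (PM _ _ (proj2_sig x) (proj2_sig y));
    gone := exist _ gone P1;
    ginv := fun x => exist _ (ginv (proj1_sig x)) (PV _ (proj2_sig x)) |}.
  - intros [x ?] [y ?] [z ?]. apply subset_eq_compat. simpl. apply gassoc.
  - intros [x ?]. apply subset_eq_compat. simpl. apply gone_l.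
  - intros [x ?]. apply subset_eq_compat. simpl. apply ginv_l.
Defined.

(** The universal property maps [G] to the subgroup cut out by [P]. Followed by the inclusion, this
    map agrees with the identity on [i] and [t], so uniqueness makes it the identity. *)
Lemma HNN_ind {H : Group} {K : H -> Prop} {phi : H -> H} {G : Group} {i : H -> G} {t : G}
    (P : G -> Prop) :
  is_HNN K phi i t -> (forall h, P (i h)) -> P t ->
  (forall x y, P x -> P y -> P (gmul x y)) -> (forall x, P x -> P (ginv x)) ->
  forall x, P x.
Proof.
  intros [Hi [Ht U]] Pi Pt PM PV.
  assert (P1 : P gone) by (rewrite <- (hom_one i Hi); apply Pi).
  set (L := sub_group P P1 PM PV).
  destruct (U L (fun h => exist _ (i h) (Pi h)) (exist _ t Pt)) as [F [Fh [Fi [Ft _]]]].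
  - intros x y. apply subset_eq_compat. apply Hi.
  - intros k Hk. apply subset_eq_compat. now apply Ht.
  - destruct (U G i t Hi Ht) as [F0 [_ [_ [_ Un]]]]. intros x.
    assert (E : proj1_sig (F x) = x).
    { rewrite (Un (fun x => proj1_sig (F x))), <- (Un (fun x => x)); auto.
      - now intros.
      - intros a b. now rewrite Fh.
      - intros h. now rewrite Fi.
      - now rewrite Ft. }
    rewrite <- E. exact (proj2_sig (F x)).
Qed.

(** * The action on a bouquet of lines *)

Lemma orbit_rep {H : Group} (K : H -> Prop) {X : Type} (act : H -> X -> X) :
  is_subgroup K -> (forall x, act gone x = x) ->
  (forall g h x, act (gmul g h) x = act g (act h x)) ->
  exists r : X -> X, (forall x, exists k, K k /\ r x = act k x) /\
    (forall k x, K k -> r (act k x) = r x).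
Proof.
  intros [K1 [KM KV]] A1 AM.
  set (O := fun x y => exists k, K k /\ y = act k x).
  exists (fun x => epsilon (inhabits x) (O x)). split.
  - intros x. apply (epsilon_spec (inhabits x) (O x)). exists x, gone. now rewrite A1.
  - intros k x Hk.
    (* [epsilon] chooses the same point for equal predicates, so the two orbits only have to be
       equal as predicates. *)
    replace (O (act k x)) with (O x).
    + apply f_equal2; [apply proof_irrelevance|reflexivity].
    + apply functional_extensionality. intros y. apply propositional_extensionality.
      split; intros [k' [Hk' ->]].
      * exists (gmul k' (ginv k)). split; auto. rewrite <- AM. now grp.
      * exists (gmul k' k). split; auto.
Qed.

(** A line for every [c], all of them glued at [Root]; [shift c] translates
    the line of [c] and fixes the others. *)
Inductive bouquet (C : Type) := Root | Ray (c : C) (b : bool) (n : nat).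
Arguments Root {C}. Arguments Ray {C}.

Definition shift {C : Type} (c : C) (b : bool) (j : bouquet C) : bouquet C :=
  match j with
  | Root => Ray c b 0
  | Ray c' b' n =>
      if excluded_middle_informative (c' = c) then
        if Bool.eqb b' b then Ray c' b' (S n)
        else match n with 0 => Root | S m => Ray c' b' m end
      else j
  end.

(** [Ray c b n] lies [n + 1] steps from [Root] on the half [b] of its line, so that [Root] sits
    between the two points with index 0. *)
Lemma shiftK {C : Type} (c : C) (b : bool) (j : bouquet C) :
  shift c (negb b) (shift c b j) = j.
Proof.
  destruct j as [|c' b' n]; simpl.
  - destruct (excluded_middle_informative (c = c)); [|easy]. now destruct b.
  - destruct (excluded_middle_informative (c' = c)) as [E|E]; simpl.
    + subst. destruct b, b'; simpl;
        repeat (try destruct n; simpl;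
          try destruct (excluded_middle_informative (c = c)); simpl; try easy).
    + destruct (excluded_middle_informative (c' = c)); easy.
Qed.

Definition shift_perm {C : Type} (c : C) : perm (bouquet C) :=
  Perm _ (shift c true) (shift c false) (shiftK c true) (shiftK c false).

Definition aut_perm {H : Group} {phi psi : H -> H} (E : forall x, psi (phi x) = x)
  (E' : forall x, phi (psi x) = x) : perm H := Perm H phi psi E E'.

(** Lines are labelled by all of [H], but [t] only shifts lines of chosen representatives [r y] of
    the cosets [K y]. This makes the shift constant on [K]-orbits. *)
Lemma HNN_bouquet {H : Group} {K : H -> Prop} {phi : H -> H} {G : Group} {i : H -> G} {t : G} :
  is_HNN K phi i t -> is_aut phi -> is_subgroup K ->
  exists (psi r : H -> H) (F : G -> Sym (H * bouquet H)),
    is_hom psi /\ (forall x, psi (phi x) = x) /\ (forall x, phi (psi x) = x) /\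
    (forall y, exists k, K k /\ r y = gmul k y) /\
    (forall k y, K k -> r (gmul k y) = r y) /\
    is_hom F /\
    (forall h y j, pfun (F (i h)) (y, j) = (gmul h y, j)) /\
    (forall y j, pfun (F t) (y, j) = (phi y, shift (r y) true j)) /\
    (forall y j, pfun (F (ginv t)) (y, j) = (psi y, shift (r (psi y)) false j)).
Proof.
  intros HNN Ha HK.
  destruct (aut_inverse phi Ha) as [psi [Hpsi [E E']]].
  destruct (orbit_rep K (fun h y => gmul h y) HK) as [r [R1 R2]].
  - intros; apply gone_l.
  - intros; now rewrite gassoc.
  - destruct (HNN_skew (fun h y => gmul h y) (aut_perm E E')
      (fun y => shift_perm (r y)) HNN) as [F [F1 [F2 [F3 F4]]]].
    + intros; apply gone_l.
    + intros; now rewrite gassoc.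
    + intros; simpl. now destruct Ha as [Hphi _].
    + intros; simpl. now rewrite R2.
    + exists psi, r, F. do 8 (split; [now auto|]). exact F4.
Qed.

Fixpoint gpow {G : Group} (x : G) (n : nat) : G :=
  match n with 0 => gone | S m => gmul x (gpow x m) end.

(* [t^-1 phi(g) t] and [g] act on [K] by the same conjugation, hence
   [c = t^-1 phi(g) t g^-1] centralizes [K]. *)
Lemma HNN_centralizer {H : Group} {K : H -> Prop} {phi : H -> H} {G : Group} {i : H -> G} {t : G} :
  is_HNN K phi i t -> is_aut phi -> is_subgroup K -> proper_in_normalizer K ->
  exists c : G, (forall k, K k -> gmul c (i k) = gmul (i k) c) /\
    (forall k k' p q, gmul (i k) (gpow c p) = gmul (i k') (gpow c q) -> k = k' /\ p = q).
Proof.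
  intros HNN Ha HK [g [Ng Kg]].
  destruct (HNN_bouquet HNN Ha HK) as [psi [r [F [P1 [P2 [P3 [R1 [R2 [Fh [Fi [Ft Fv]]]]]]]]]]].
  destruct HNN as [Hi [Ht _]]. destruct HK as [K1 [KM KV]].
  exists (gmul (gmul (ginv t) (i (phi g))) (gmul t (i (ginv g)))).
  set (c := gmul _ _).
  assert (Rg : r (ginv g) <> r gone).
  { intros E. destruct (R1 (ginv g)) as [k [Hk Ek]], (R1 gone) as [l [Hl El]].
    apply Kg. rewrite Ek, El, gone_r in E.
    replace g with (gmul (ginv l) k); [now apply KM; [apply KV|]|].
    apply (gcancel_r (ginv g)). rewrite <- gassoc, E. now grp. }
  (* From the right: [g^-1] and [t] move [j] forward on the line of [r (ginv g)]; then [phi(g)] and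
     [t^-1] restore the first coordinate and move [j] backward on the line of [r gone]. *)
  assert (Fc : forall j, pfun (F c) (gone, j)
      = (gone, shift (r gone) false (shift (r (ginv g)) true j))).
  { intros j. unfold c. rewrite !Fh. simpl. rewrite Fi, Ft, Fi, Fv, gone_r.
    replace (gmul (phi g) (phi (ginv g))) with (phi gone);
      [|destruct Ha as [Hphi _]; rewrite <- Hphi; now grp].
    now rewrite P2. }
  (* Once off [Root] on the line of [g^-1], the backward shift of the other line has no effect, so
     every factor [c] advances by one. *)
  assert (Fcn : forall n, pfun (F (gpow c n)) (gone, Root)
      = (gone, match n with 0 => Root | S m => Ray (r (ginv g)) true m end)).
  { induction n as [|n IH]; simpl.
    - now rewrite (hom_one F Fh).
    - rewrite Fh. simpl. rewrite IH, Fc. f_equal. destruct n as [|n]; simpl.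
      + destruct (excluded_middle_informative (r (ginv g) = r gone)); easy.
      + destruct (excluded_middle_informative (r (ginv g) = r (ginv g))); [|easy]. simpl.
        destruct (excluded_middle_informative (r (ginv g) = r gone)); easy. }
  split.
  - intros k Hk.
    assert (Hgk : K (gmul (gmul (ginv g) k) g)).
    { apply Ng. match goal with |- K ?x => replace x with k; [easy|now grp] end. }
    assert (T : forall k, K k -> gmul t (i k) = gmul (i (phi k)) t).
    { intros k' Hk'. rewrite <- Ht by easy. now grp. }
    assert (T' : forall k, K k -> gmul (ginv t) (i (phi k)) = gmul (i k) (ginv t)).
    { intros k' Hk'. rewrite <- Ht by easy. now grp. }
    unfold c. rewrite !gassoc, <- T' by easy.
    rewrite <- !(gassoc _ (ginv t)). f_equal. rewrite <- !Hi. rewrite <- !gassoc, <- Hi.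
    replace (gmul (ginv g) k) with (gmul (gmul (gmul (ginv g) k) g) (ginv g)) by now grp.
    rewrite Hi, (gassoc _ t), T by easy. rewrite <- gassoc, gassoc, <- Hi.
    f_equal. f_equal. destruct Ha as [Hphi _]. rewrite <- !Hphi. f_equal. now grp.
  - intros k k' p q E.
    (* The image of [(1, Root)] shows [k] in its first coordinate and [p] in its second. *)
    assert (E2 : pfun (F (gmul (i k) (gpow c p))) (gone, Root)
      = pfun (F (gmul (i k') (gpow c q))) (gone, Root)) by now rewrite E.
    rewrite !Fh in E2. simpl in E2. rewrite !Fcn, !Fi, !gone_r in E2.
    injection E2 as E3 E4. split; [easy|]. destruct p, q; try easy. now injection E4 as ->.
Qed.

(** Passing to [g^-1] turns right multiplication into the action. At [Root] the first coordinate is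
    recorded; on a ray the record is frozen. Hence [t] changes it only on leaving or reaching
    [Root], and then by an element of [K] or [phi(K)]. *)
Lemma HNN_coarse_retraction {H : Group} {K : H -> Prop} {phi : H -> H} {G : Group}
    {i : H -> G} {t : G} :
  is_HNN K phi i t -> is_aut phi -> is_subgroup K -> finite_subset K ->
  exists p : G -> H, (forall h, p (i h) = h) /\
    forall s, exists T : list H, forall g, In (gmul (ginv (p g)) (p (gmul g s))) T.
Proof.
  intros HNN Ha HK [lK HlK].
  destruct (HNN_bouquet HNN Ha HK) as [psi [r [F [P1 [P2 [P3 [R1 [R2 [Fh [Fi [Ft Fv]]]]]]]]]]].
  pose proof HNN as [Hi _]. destruct HK as [K1 [KM KV]]. pose proof Ha as [Hphi _].
  (* Between [Root] and the positive half of the line of [c], the first coordinate on the [Root]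
     side lies in [K c]; for the negative half it lies in [phi(K c)]. The labels on rays are the
     inverses of [c] and [phi c] accordingly. *)
  set (root_label := fun z : H * bouquet H => match snd z with
    | Root => ginv (fst z)
    | Ray c true _ => ginv c
    | Ray c false _ => ginv (phi c)
    end).
  exists (fun g => root_label (pfun (F (ginv g)) (gone, Root))). split.
  { intros h. rewrite <- hom_inv, Fi by easy. unfold root_label. simpl. now grp. }
  set (p := fun g => root_label (pfun (F (ginv g)) (gone, Root))).
  apply (HNN_ind (fun s => exists T : list H, forall g, In (gmul (ginv (p g)) (p (gmul g s))) T) HNN).
  - intros h. exists [gone; h]. intros g. unfold p.
    rewrite ginv_mul, Fh, <- hom_inv by easy. simpl.
    destruct (pfun (F (ginv g)) (gone, Root)) as [y j]. rewrite Fi.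
    destruct j as [|c b n]; unfold root_label; simpl.
    + right; left. now grp.
    + left. now rewrite ginv_l.
  - exists (gone :: map (fun k => k) lK ++ map phi lK).
    assert (D : forall x, (x = gone \/ K x \/ exists k, K k /\ x = phi k) ->
        In x (gone :: map (fun k => k) lK ++ map phi lK)).
    { intros x [->|[Hx|[k [Hk ->]]]]; [now left| |]; right; apply in_or_app.
      - left. rewrite map_id. auto.
      - right. apply in_map. auto. }
    intros g. apply D.
    assert (Ep : p (gmul g t) = root_label (pfun (F (ginv t)) (pfun (F (ginv g)) (gone, Root))))
      by (unfold p; now rewrite ginv_mul, Fh).
    rewrite Ep. unfold p. clear Ep.
    destruct (pfun (F (ginv g)) (gone, Root)) as [y j]. rewrite Fv.
    destruct (R1 (psi y)) as [k [Hk Ek]].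
    assert (Hphik : forall x y, phi (gmul x y) = gmul (phi x) (phi y)) by auto.
    destruct j as [|c b n]; unfold root_label; simpl.
    + right; right. exists (ginv k). split; auto. rewrite Ek, Hphik, P3, (hom_inv phi) by easy.
      now grp.
    + destruct (excluded_middle_informative (c = r (psi y))) as [->|N]; simpl.
      * destruct b; simpl; [|left; now rewrite ginv_l].
        destruct n; [|left; now rewrite ginv_l]. right; left. rewrite Ek. now grp.
      * destruct b; left; now rewrite ginv_l.
  - intros x y [T1 H1] [T2 H2].
    exists (map (fun z => gmul (fst z) (snd z)) (list_prod T1 T2)). intros g.
    apply in_map_iff.
    exists (gmul (ginv (p g)) (p (gmul g x)), gmul (ginv (p (gmul g x))) (p (gmul (gmul g x) y))).
    split; [simpl; rewrite !gassoc; now grp|now apply in_prod].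
  - intros x [T HT]. exists (map ginv T). intros g.
    replace (gmul (ginv (p g)) (p (gmul g (ginv x)))) with
      (ginv (gmul (ginv (p (gmul g (ginv x)))) (p (gmul (gmul g (ginv x)) x)))).
    + now apply in_map.
    + rewrite gmulVK. now grp.
Qed.

(** * Word metrics and slim triangles *)

Lemma last_cons {X : Type} (x y : X) (p : list X) : last (y :: p) x = last p y.
Proof.
  revert x y. induction p as [|z p IH]; intros x y; [easy|].
  change (last (z :: p) x = last (z :: p) y). now rewrite !IH.
Qed.

Lemma last_concat {X : Type} (x : X) (p q : list X) : last (p ++ q) x = last q (last p x).
Proof.
  revert x. induction p as [|y p IH]; intros x; [easy|].
  change ((y :: p) ++ q) with (y :: (p ++ q)). now rewrite !last_cons.
Qed.

Lemma last_map {X Y : Type} (f : X -> Y) (x : X) (p : list X) :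
  last (map f p) (f x) = f (last p x).
Proof.
  revert x. induction p as [|y p IH]; intros x; [easy|].
  change (map f (y :: p)) with (f y :: map f p). now rewrite !last_cons.
Qed.

Lemma adj_sym {G : Group} (S : list G) (x y : G) : adj S x y -> adj S y x.
Proof. intros [s [Hs [->| ->]]]; exists s; split; auto; [right|left]; now grp. Qed.

Lemma is_path_app {G : Group} (S : list G) (x : G) (p q : list G) :
  is_path S x (p ++ q) <-> is_path S x p /\ is_path S (last p x) q.
Proof.
  revert x. induction p as [|y p IH]; intros x; [simpl; tauto|].
  rewrite last_cons. simpl. rewrite IH. tauto.
Qed.

Lemma is_path_map {G L : Group} (S : list G) (S' : list L) (f : G -> L) :
  (forall x y, adj S x y -> adj S' (f x) (f y)) ->
  forall p x, is_path S x p -> is_path S' (f x) (map f p).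
Proof.
  intros Hf p. induction p as [|y p IH]; intros x; simpl; [easy|]. intros [Ha Hp]. auto.
Qed.

Lemma is_path_rev {G : Group} (S : list G) (p : list G) : forall x, is_path S x p ->
  exists q, is_path S (last p x) q /\ last q (last p x) = x /\ length q = length p.
Proof.
  induction p as [|y p IH]; intros x.
  - exists []. easy.
  - intros [Ha Hp]. destruct (IH y Hp) as [q [Q1 [Q2 Q3]]]. rewrite !last_cons.
    exists (q ++ [x]). rewrite is_path_app, last_concat, Q2, length_app. simpl.
    repeat split; auto using adj_sym. lia.
Qed.

Definition is_dist {G : Group} (S : list G) (d : G -> G -> nat) : Prop :=
  forall x y n, dist_le S x y n <-> d x y <= n.

Lemma adj_mul {G : Group} (S : list G) (a x y : G) : adj S x y -> adj S (gmul a x) (gmul a y).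
Proof.
  intros [s [Hs [->| ->]]]; exists s; split; auto; rewrite gassoc; auto.
Qed.

Lemma dist_le_mul {G : Group} (S : list G) (a x y : G) (n : nat) :
  dist_le S x y n -> dist_le S (gmul a x) (gmul a y) n.
Proof.
  intros [p [P1 [P2 P3]]]. exists (map (gmul a) p). split; [|split].
  - apply (is_path_map S S (gmul a)); auto using adj_mul.
  - now rewrite last_map, P2.
  - now rewrite length_map.
Qed.

Lemma nat_least (P : nat -> Prop) : (exists n, P n) -> exists n, P n /\ forall m, P m -> n <= m.
Proof.
  intros [n Hn]. revert Hn. induction n as [n IH] using (well_founded_induction lt_wf).
  intros Hn. destruct (classic (exists m, m < n /\ P m)) as [[m [Hm Pm]]|N].
  - exact (IH m Hm Pm).
  - exists n. split; auto. intros m Pm. destruct (le_lt_dec n m); auto. exfalso; eauto.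
Qed.

Lemma nat_greatest (P : nat -> Prop) (b : nat) : (exists n, P n) -> (forall n, P n -> n <= b) ->
  exists n, P n /\ forall m, P m -> m <= n.
Proof.
  intros [n Hn] Hb.
  destruct (nat_least (fun k => k <= b /\ P (b - k))) as [k [[Hk Pk] Hl]].
  - exists (b - n). split; [lia|]. specialize (Hb n Hn). now replace (b - (b - n)) with n by lia.
  - exists (b - k). split; auto. intros m Pm. specialize (Hb m Pm).
    specialize (Hl (b - m)). replace (b - (b - m)) with m in Hl by lia.
    assert (k <= b - m) by (apply Hl; split; auto; lia). lia.
Qed.

Lemma dist_exists {G : Group} (S : list G) : generates S -> exists d, is_dist S d.
Proof.
  intros Gen.
  assert (E : forall xy : G * G, exists n,
    dist_le S (fst xy) (snd xy) n /\ forall m, dist_le S (fst xy) (snd xy) m -> n <= m).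
  { intros [x y]. simpl. apply nat_least.
    destruct (Gen (gmul (ginv x) y)) as [p [P1 P2]]. exists (length p).
    replace y with (gmul x (gmul (ginv x) y)) by now grp.
    rewrite <- (gone_r x) at 1. apply dist_le_mul. exists p. auto. }
  set (d := fun x y => proj1_sig (constructive_indefinite_description _ (E (x, y)))).
  exists d. intros x y n.
  assert (Hd : dist_le S x y (d x y) /\ forall m, dist_le S x y m -> d x y <= m)
    by exact (proj2_sig (constructive_indefinite_description _ (E (x, y)))).
  destruct Hd as [D1 D2]. split; auto. intros Hn. destruct D1 as [p [P1 [P2 P3]]].
  exists p. repeat split; auto. lia.
Qed.

Lemma dist_refl {G : Group} {S : list G} {d} (Hd : is_dist S d) (x : G) : d x x = 0.
Proof. enough (d x x <= 0) by lia. apply Hd. now exists []. Qed.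

Lemma dist_eq {G : Group} {S : list G} {d} (Hd : is_dist S d) (x y : G) : d x y = 0 -> x = y.
Proof.
  intros E. assert (L : d x y <= 0) by lia. apply Hd in L. destruct L as [[|] [? [? ?]]]; auto.
  simpl in *. lia.
Qed.

Lemma dist_path {G : Group} {S : list G} {d} (Hd : is_dist S d) (x : G) (p : list G) :
  is_path S x p -> d x (last p x) <= length p.
Proof. intros Hp. apply Hd. exists p. auto. Qed.

Lemma dist_geod {G : Group} {S : list G} {d} (Hd : is_dist S d) (x y : G) :
  exists p, geodesic S x p y /\ length p = d x y.
Proof.
  assert (L : d x y <= d x y) by lia. apply Hd in L. destruct L as [p [P1 [P2 P3]]].
  assert (d x y <= length p) by (rewrite <- P2; now apply (dist_path Hd)).
  exists p. split; [|lia]. split; [easy|]. split; [easy|]. intros q Q1 Q2.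
  enough (d x y <= length q) by lia. rewrite <- Q2. now apply (dist_path Hd).
Qed.

Lemma geod_length {G : Group} {S : list G} {d} (Hd : is_dist S d) (x y : G) (p : list G) :
  geodesic S x p y <-> is_path S x p /\ last p x = y /\ length p = d x y.
Proof.
  split.
  - intros [P1 [P2 P3]]. split; [easy|]. split; [easy|].
    destruct (dist_geod Hd x y) as [q [[Q1 [Q2 Q3]] Q4]].
    specialize (P3 q Q1 Q2). specialize (Q3 p P1 P2). lia.
  - intros [P1 [P2 P3]]. split; [easy|]. split; [easy|]. intros q Q1 Q2.
    rewrite P3, <- Q2. now apply (dist_path Hd).
Qed.

Lemma dist_sym {G : Group} {S : list G} {d} (Hd : is_dist S d) (x y : G) : d x y = d y x.
Proof.
  enough (forall x y, d x y <= d y x) by (apply Nat.le_antisymm; auto). clear x y. intros x y.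
  destruct (dist_geod Hd y x) as [p [[P1 [P2 _]] P3]].
  destruct (is_path_rev S p y P1) as [q [Q1 [Q2 Q3]]].
  rewrite P2 in Q1, Q2. rewrite <- P3, <- Q3, <- Q2. now apply (dist_path Hd).
Qed.

Lemma dist_tri {G : Group} {S : list G} {d} (Hd : is_dist S d) (x y z : G) :
  d x z <= d x y + d y z.
Proof.
  destruct (dist_geod Hd x y) as [p [[P1 [P2 _]] P3]].
  destruct (dist_geod Hd y z) as [q [[Q1 [Q2 _]] Q3]].
  rewrite <- P3, <- Q3, <- length_app, <- Q2, <- P2, <- last_concat.
  apply (dist_path Hd). rewrite is_path_app, P2. auto.
Qed.

Lemma dist_mul {G : Group} {S : list G} {d} (Hd : is_dist S d) (a x y : G) :
  d (gmul a x) (gmul a y) = d x y.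
Proof.
  assert (L : forall a x y, d (gmul a x) (gmul a y) <= d x y).
  { intros. apply Hd, dist_le_mul, Hd. lia. }
  apply Nat.le_antisymm; auto.
  specialize (L (ginv a) (gmul a x) (gmul a y)). now rewrite !gassoc, !ginv_l, !gone_l in L.
Qed.

Lemma dist_mul1 {G : Group} {S : list G} {d} (Hd : is_dist S d) (x y : G) :
  d x (gmul x y) = d gone y.
Proof. now rewrite <- (dist_mul Hd x gone y), gone_r. Qed.

Lemma in_path_split {X : Type} (x v : X) (p : list X) : In v (x :: p) ->
  exists p1 p2, p = p1 ++ p2 /\ last p1 x = v.
Proof.
  intros [->|Hv].
  - now exists [], p.
  - destruct (in_split _ _ Hv) as [l1 [l2 ->]]. exists (l1 ++ [v]), l2.
    now rewrite <- app_assoc, last_concat.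
Qed.

(** The points of all geodesics from [x] to [y], described by distances so that coarse arguments can
    avoid edge paths. *)
Definition between {G : Group} (d : G -> G -> nat) (x y v : G) : Prop :=
  d x v + d v y = d x y.

Lemma between_geod {G : Group} {S : list G} {d} (Hd : is_dist S d) (x y : G) (p : list G) :
  geodesic S x p y -> forall p1 p2, p = p1 ++ p2 ->
  d x (last p1 x) = length p1 /\ d (last p1 x) y = length p2.
Proof.
  rewrite (geod_length Hd). intros [P1 [P2 P3]] p1 p2 ->.
  rewrite is_path_app in P1. destruct P1 as [P0 P1].
  rewrite last_concat in P2. rewrite length_app in P3.
  pose proof (dist_path Hd _ _ P0) as L1. pose proof (dist_path Hd _ _ P1) as L2. rewrite P2 in L2.
  pose proof (dist_tri Hd x (last p1 x) y). lia.
Qed.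

Lemma in_geod_between {G : Group} {S : list G} {d} (Hd : is_dist S d) (x y v : G) (p : list G) :
  geodesic S x p y -> In v (x :: p) -> between d x y v.
Proof.
  intros Hp Hv. destruct (in_path_split x v p Hv) as [p1 [p2 [E <-]]].
  destruct (between_geod Hd x y p Hp p1 p2 E) as [E1 E2].
  apply (geod_length Hd) in Hp. destruct Hp as [_ [_ E3]].
  subst p. rewrite length_app in E3. unfold between. lia.
Qed.

Lemma between_point {G : Group} {S : list G} {d} (Hd : is_dist S d) (x y : G) (n : nat) :
  n <= d x y -> exists v, between d x y v /\ d x v = n.
Proof.
  intros Hn. destruct (dist_geod Hd x y) as [p [Hp Lp]].
  destruct (between_geod Hd x y p Hp (firstn n p) (skipn n p)) as [E1 E2].
  - now rewrite firstn_skipn.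
  - exists (last (firstn n p) x). unfold between.
    rewrite length_firstn in E1. rewrite length_skipn in E2. lia.
Qed.

Definition slim {G : Group} (d : G -> G -> nat) (delta : nat) : Prop :=
  forall x y z v, between d x y v ->
    exists w, (between d y z w \/ between d x z w) /\ d v w <= delta.

Lemma between_sym {G : Group} {S : list G} {d} (Hd : is_dist S d) (x y v : G) :
  between d x y v -> between d y x v.
Proof.
  unfold between. rewrite (dist_sym Hd y v), (dist_sym Hd v x), (dist_sym Hd y x). lia.
Qed.

(** Joining geodesics from [x] to [v] and from [v] to [y] gives a geodesic side through [v], to
    which slimness of path triangles applies. *)
Lemma hyperbolic_slim {G : Group} {S : list G} {d} (Hd : is_dist S d) (delta : nat) :
  (forall (x y z : G) (p q r : list G),
      geodesic S x p y -> geodesic S y q z -> geodesic S z r x ->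
      forall v, In v (x :: p) ->
        exists w, (In w (y :: q) \/ In w (z :: r)) /\ dist_le S v w delta) ->
  slim d delta.
Proof.
  intros Hyp x y z v Hv.
  destruct (dist_geod Hd x v) as [p1 [Hp1 L1]]. destruct (dist_geod Hd v y) as [p2 [Hp2 L2]].
  destruct (dist_geod Hd y z) as [q [Hq _]]. destruct (dist_geod Hd z x) as [r [Hr _]].
  destruct Hp1 as [A1 [B1 _]]. destruct Hp2 as [A2 [B2 _]].
  destruct (Hyp x y z (p1 ++ p2) q r) with (v := v) as [w [Hw Hvw]]; auto.
  - apply (geod_length Hd). rewrite is_path_app, last_concat, length_app, B1. unfold between in Hv.
    repeat split; auto. lia.
  - destruct p1 as [|a p1]; [left; easy|]. right. apply in_or_app. left.
    rewrite <- B1. rewrite last_cons. destruct (exists_last (l := a :: p1)) as [l' [b E]]; [easy|].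
    rewrite <- last_cons with (x := x), E, last_last. apply in_or_app. simpl; auto.
  - exists w. split; [|now apply Hd]. destruct Hw as [Hw|Hw]; [left|right].
    + now apply (in_geod_between Hd y z w q).
    + apply (between_sym Hd). now apply (in_geod_between Hd z x w r).
Qed.

(** Bisection: the triangle on [u a], [u b] and a middle point of the chain moves [v] by at most
    [delta] to a chord over at most half of the range. After [k] rounds a chord of length at most
    [M] remains. *)
Lemma slim_log {G : Group} {S : list G} {d} (Hd : is_dist S d) {delta : nat} (Hs : slim d delta)
    (M : nat) (u : nat -> G) (k : nat) :
  forall a b, a <= b -> b - a <= 2 ^ k ->
  (forall j, a <= j -> j < b -> d (u j) (u (1 + j)) <= M) ->
  forall v, between d (u a) (u b) v ->
  exists j, a <= j /\ j <= b /\ d v (u j) <= k * delta + M.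
Proof.
  induction k as [|k IH]; intros a b Hab Hk Hu v Hv.
  - exists a. split; [lia|]. split; [lia|]. unfold between in Hv. rewrite (dist_sym Hd v).
    destruct (Nat.eq_dec a b) as [->|N].
    + rewrite (dist_refl Hd) in Hv. lia.
    + simpl in Hk. replace b with (1 + a) in * by lia. specialize (Hu a). lia.
  - destruct (le_lt_dec (b - a) (2 ^ k)) as [L|L].
    + destruct (IH a b Hab L Hu v Hv) as [j [? [? ?]]]. exists j. simpl. lia.
    + set (c := a + 2 ^ k).
      destruct (Hs (u a) (u b) (u c) v Hv) as [w [Hw Hvw]].
      simpl in Hk.
      assert (Hj : exists j, a <= j /\ j <= b /\ d w (u j) <= k * delta + M).
      { destruct Hw as [Hw|Hw].
        - apply (between_sym Hd) in Hw. destruct (IH c b) with (v := w) as [j [? [? ?]]]; auto.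
          + unfold c. lia.
          + unfold c. lia.
          + intros j' ? ?. apply Hu; unfold c in *; lia.
          + exists j. unfold c in *. lia.
        - destruct (IH a c) with (v := w) as [j [? [? ?]]]; auto.
          + unfold c. lia.
          + unfold c. lia.
          + intros j' ? ?. apply Hu; unfold c in *; lia.
          + exists j. unfold c in *. lia. }
      destruct Hj as [j [? [? Hj]]]. exists j. split; [lia|]. split; [lia|].
      pose proof (dist_tri Hd v w (u j)). simpl. lia.
Qed.

(** Since [k * k <= 4 * 2 ^ pred k], the hypotheses bound [k * k] linearly in [k]; this bounds [k],
    and then [D]. The [pred] comes from rounding a logarithm up, and [6] from the length of the
    detour in [geod_near_quasi_geod]. *)
Lemma log_growth (delta M : nat) : exists D1, forall D k,
  2 ^ pred k <= 6 * M * D + 1 -> D <= k * delta + 2 * delta + M -> D <= D1.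
Proof.
  assert (Sq : forall k, k * k <= 4 * 2 ^ pred k).
  { assert (forall k, S k * S k <= 4 * 2 ^ k).
    { intros k. induction k as [|k IH]; [simpl; lia|].
      destruct (le_lt_dec k 2); [do 3 (destruct k as [|k]; [simpl; lia|]); lia|].
      rewrite Nat.pow_succ_r'. nia. }
    intros [|k]; [lia|]. apply H. }
  set (C := 4 * (6 * M * (delta + 2 * delta + M) + 1)).
  exists (C * delta + 2 * delta + M). intros D k H1 H2.
  enough (k <= C) by nia.
  destruct k as [|k]; [lia|]. specialize (Sq (S k)).
  assert (S k * S k <= 4 * (6 * M * (S k * (delta + 2 * delta + M)) + 1)) by nia.
  assert (S k * S k <= S k * C) by (unfold C; nia). nia.
Qed.

(** * Stability of quasi-geodesics *)

Definition quasi_geod {G : Group} (d : G -> G -> nat) (M : nat) (u : nat -> G) (n : nat) : Prop :=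
  (forall j, j < n -> d (u j) (u (1 + j)) <= M) /\
  (forall a b, a <= b -> b <= n -> b - a <= M * d (u a) (u b)).

(** The part of [u] between [a] and [b] has at most [M * d (u a) (u b)] steps, so the bisection
    depth [k] in [slim_log] is logarithmic in the length of the chord. *)
Lemma slim_near {G : Group} {S : list G} {d} (Hd : is_dist S d) {delta M : nat} (Hs : slim d delta)
    (u : nat -> G) (n : nat) (Hu : quasi_geod d M u n) (a b : nat) (w : G) :
  a <= n -> b <= n -> between d (u a) (u b) w ->
  exists j k, j <= n /\ d w (u j) <= k * delta + M /\ 2 ^ pred k <= M * d (u a) (u b) + 1.
Proof.
  destruct Hu as [U1 U2].
  assert (Main : forall a b, a <= b -> b <= n -> between d (u a) (u b) w ->
    exists j k, j <= n /\ d w (u j) <= k * delta + M /\ 2 ^ pred k <= M * d (u a) (u b) + 1).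
  { clear a b. intros a b Hab Hb Hw. specialize (U2 a b Hab Hb).
    assert (Hk : exists k, b - a <= 2 ^ k /\ 2 ^ pred k <= (b - a) + 1).
    { destruct (le_lt_dec (b - a) 1) as [L|L].
      - exists 0. simpl. lia.
      - exists (Nat.log2_up (b - a)). pose proof (Nat.log2_up_spec _ L). lia. }
    destruct Hk as [k [K1 K2]].
    destruct (slim_log Hd Hs M u k a b Hab K1) with (v := w) as [j [? [? ?]]]; auto.
    - intros j ? ?. apply U1. lia.
    - exists j, k. lia. }
  intros Ha Hb Hw. destruct (le_lt_dec a b) as [L|L]; [auto|].
  rewrite (dist_sym Hd (u a)). apply Main; [lia|lia|]. now apply (between_sym Hd).
Qed.

(* Take the point [v] of the geodesic farthest from the quasi-geodesic, at distance [D].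
   The detour leaving the geodesic [2 D] before and after [v] has length linear in [D],
   but it passes within logarithmic distance of [v]. *)
Lemma geod_near_quasi_geod (delta M : nat) : exists D1,
  forall (G : Group) (S : list G) d, is_dist S d -> slim d delta ->
  forall u n, quasi_geod d M u n -> forall v, between d (u 0) (u n) v ->
  exists j, j <= n /\ d v (u j) <= D1.
Proof.
  destruct (log_growth delta M) as [D1 HD1]. exists D1.
  intros G S d Hd Hs u n Hu.
  set (P := fun D => exists v, between d (u 0) (u n) v /\ forall j, j <= n -> D <= d v (u j)).
  destruct (nat_greatest P (d (u 0) (u n))) as [D [[v [Hv Dv]] HD]].
  - exists 0, (u 0). split; [|intros; lia]. unfold between. rewrite (dist_refl Hd). lia.
  - intros D [v [Hv Dv]]. specialize (Dv 0). rewrite (dist_sym Hd v) in Dv.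
    unfold between in Hv. lia.
  - assert (Near : forall v', between d (u 0) (u n) v' -> exists j, j <= n /\ d v' (u j) <= D).
    { intros v' Hv'. apply NNPP. intros N.
      assert (Pn : P (1 + D)).
      { exists v'. split; auto. intros j Hj. apply not_lt. intros L. apply N. exists j.
        split; auto. lia. }
      apply HD in Pn. lia. }
    enough (D <= D1) by
      (intros v' Hv'; destruct (Near v' Hv') as [j [? ?]]; exists j; split; auto; lia).
    (* If the endpoint [u e] is nearer than [2 D] to [v], it serves as [y]. Otherwise [y] is at
       distance [2 D] from [v], and the connection from [y] to [u a], of length at most [D], stays
       at least [D] away from [v]. *)
    assert (Side : forall e, e <= n ->
      (forall y, between d (u e) v y -> between d (u 0) (u n) y) ->
      exists y a, a <= n /\ between d (u e) v y /\ d y (u a) <= D /\ d y v <= 2 * D /\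
        forall w, between d y (u a) w -> D <= d v w).
    { intros e He Hy. destruct (le_lt_dec (2 * D) (d v (u e))) as [L|L].
      - destruct (between_point Hd v (u e) (2 * D) L) as [y [Y1 Y2]].
        apply (between_sym Hd) in Y1.
        destruct (Near y) as [a [A1 A2]]; [auto|]. exists y, a. rewrite (dist_sym Hd y v).
        repeat split; auto; try lia. intros w Hw.
        pose proof (dist_tri Hd v w y). rewrite (dist_sym Hd w y) in *. unfold between in Hw. lia.
      - exists (u e), e. rewrite (dist_sym Hd _ v). unfold between. rewrite !(dist_refl Hd).
        repeat split; try lia. intros w Hw.
        replace w with (u e); [auto|]. apply (dist_eq Hd). lia. }
    destruct (Side 0) as [y [a [Ha [Hy [Y1 [Y2 Y3]]]]]]; [lia| |].
    { intros y Hy. unfold between in *. pose proof (dist_tri Hd y v (u n)).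
      pose proof (dist_tri Hd (u 0) y (u n)). lia. }
    destruct (Side n) as [z [b [Hb [Hz [Z1 [Z2 Z3]]]]]]; [lia| |].
    { intros z Hz. apply (between_sym Hd). apply (between_sym Hd) in Hv. unfold between in *.
      pose proof (dist_tri Hd z v (u 0)). pose proof (dist_tri Hd (u n) z (u 0)). lia. }
    assert (Hyz : between d y z v).
    { apply (between_sym Hd) in Hz. unfold between in *.
      pose proof (dist_tri Hd y v z). pose proof (dist_tri Hd y z (u n)).
      pose proof (dist_tri Hd (u 0) y (u n)). lia. }
    (* The bound is [D + 2 D + 2 D + D], along [u a], [y], [v], [z], [u b]. *)
    assert (Dab : d (u a) (u b) <= 6 * D).
    { pose proof (dist_tri Hd (u a) y (u b)). pose proof (dist_tri Hd y v (u b)).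
      pose proof (dist_tri Hd v z (u b)). rewrite (dist_sym Hd (u a) y) in *.
      rewrite (dist_sym Hd v z) in *. lia. }
    (* Two triangles fill the quadrilateral [y], [z], [u b], [u a]. If [v] is near a connecting
       side, then [D <= 2 * delta]; if it is near the chord from [u a] to [u b], the logarithmic
       bound applies. *)
    destruct (Hs y z (u a) v Hyz) as [w1 [[W1|W1] V1]].
    + destruct (Hs z (u a) (u b) w1 W1) as [w2 [[W2|W2] V2]].
      * destruct (slim_near Hd Hs u n Hu a b w2 Ha Hb W2) as [j [k [J1 [J2 J3]]]].
        apply (HD1 D k); [nia|]. specialize (Dv j J1).
        pose proof (dist_tri Hd v w1 (u j)). pose proof (dist_tri Hd w1 w2 (u j)). lia.
      * specialize (Z3 w2 W2). pose proof (dist_tri Hd v w1 w2).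
        apply (HD1 D 0); simpl; lia.
    + specialize (Y3 w1 W1). apply (HD1 D 0); simpl; lia.
Qed.

(** Let [v] be the farthest point along the geodesic that is near some [u a] with [a <= j]. Its
    successor is near some [u b] with [j <= b]. Then [u a] and [u b] are at distance at most
    [2 * D1 + 1], so [j - a] is bounded and [u j] is close to [v]. *)
Lemma quasi_geod_near_geod (delta M : nat) : exists D2,
  forall (G : Group) (S : list G) d, is_dist S d -> slim d delta ->
  forall u n, quasi_geod d M u n -> forall j, j <= n ->
  exists v, between d (u 0) (u n) v /\ d (u j) v <= D2.
Proof.
  destruct (geod_near_quasi_geod delta M) as [D1 HD1].
  exists (D1 + M * (M * (2 * D1 + 1))).
  intros G S d Hd Hs u n Hu j Hj. specialize (HD1 G S d Hd Hs u n Hu).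
  destruct Hu as [U1 U2].
  assert (U3 : forall b a, a <= b -> b <= n -> d (u a) (u b) <= M * (b - a)).
  { induction b as [|b IH]; intros a Hab Hb.
    - replace a with 0 by lia. rewrite (dist_refl Hd). lia.
    - destruct (Nat.eq_dec a (1 + b)) as [->|N]; [rewrite (dist_refl Hd); lia|].
      specialize (IH a ltac:(lia) ltac:(lia)). specialize (U1 b Hb).
      pose proof (dist_tri Hd (u a) (u b) (u (1 + b))).
      replace (Datatypes.S b - a) with (1 + (b - a)) by lia. change (Datatypes.S b) with (1 + b).
      rewrite Nat.mul_add_distr_l. lia. }
  set (P := fun s => exists v a, between d (u 0) (u n) v /\ d (u 0) v = s /\ a <= j /\
    d v (u a) <= D1).
  destruct (nat_greatest P (d (u 0) (u n))) as [s [[v [a [Hv [Es [Ha Da]]]]] Hmax]].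
  - exists 0, (u 0), 0. rewrite (dist_refl Hd). repeat split; try lia.
    unfold between. rewrite (dist_refl Hd). lia.
  - intros s [v [a [Hv [Es _]]]]. unfold between in Hv. lia.
  - assert (Hb : exists b, b <= n /\ j <= b /\ d v (u b) <= D1 + 1).
    { destruct (Nat.eq_dec (d v (u n)) 0) as [E|N].
      - exists n. lia.
      - destruct (between_point Hd v (u n) 1) as [v' [V1 V2]]; [lia|].
        assert (Hv' : between d (u 0) (u n) v' /\ d (u 0) v' = s + 1).
        { unfold between in *. pose proof (dist_tri Hd (u 0) v v').
          pose proof (dist_tri Hd (u 0) v' (u n)). lia. }
        destruct Hv' as [B1 B2]. destruct (HD1 v' B1) as [b [L1 L2]]. exists b.
        pose proof (dist_tri Hd v v' (u b)).
        split; [easy|]. split; [|lia].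
        destruct (le_lt_dec j b); auto. exfalso.
        assert (Ps : P (s + 1)) by (exists v', b; repeat split; auto; lia).
        apply Hmax in Ps. lia. }
    destruct Hb as [b [B1 [B2 B3]]]. exists v. split; auto.
    pose proof (dist_tri Hd (u a) v (u b)). rewrite (dist_sym Hd (u a) v) in *.
    pose proof (U2 a b ltac:(lia) B1). pose proof (U3 j a Ha Hj).
    pose proof (dist_tri Hd (u j) (u a) v).
    rewrite (dist_sym Hd (u j) (u a)) in *.
    assert (M * d (u a) (u b) <= M * (2 * D1 + 1)) by (apply Nat.mul_le_mono_l; lia).
    assert (M * (j - a) <= M * (M * (2 * D1 + 1))) by (apply Nat.mul_le_mono_l; lia).
    rewrite (dist_sym Hd (u a) v) in *. lia.
Qed.

(** Vertices number [a] and [b] of a geodesic are at distance [b - a], which turns the two Lipschitz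
    bounds into those of [quasi_geod]. *)
Lemma geod_quasi_geod {H G : Group} {SH : list H} {dH} {dG : G -> G -> nat}
    (HdH : is_dist SH dH) (f : H -> G) (M : nat) :
  (forall x y, dH x y <= M * dG (f x) (f y)) -> (forall x y, dG (f x) (f y) <= M * dH x y) ->
  forall x p y, geodesic SH x p y -> exists u n, quasi_geod dG M u n /\
    u 0 = f x /\ u n = f y /\
    (forall j, j <= n -> exists v, In v (x :: p) /\ u j = f v) /\
    (forall v, In v (x :: p) -> exists j, j <= n /\ u j = f v).
Proof.
  intros L1 L2 x p y Hp.
  set (w := fun j => last (firstn j p) x).
  assert (W : forall a b, a <= b -> b <= length p -> dH (w a) (w b) = b - a).
  { intros a b Hab Hb.
    assert (Ea : dH x (w a) = a).
    { destruct (between_geod HdH x y p Hp (firstn a p) (skipn a p)) as [E _].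
      - now rewrite firstn_skipn.
      - rewrite length_firstn in E. unfold w. lia. }
    destruct (between_geod HdH x y p Hp (firstn b p) (skipn b p)) as [Eb _].
    { now rewrite firstn_skipn. }
    rewrite length_firstn in Eb. fold (w b) in Eb.
    assert (Hl : dH (w a) (w b) <= b - a).
    { destruct Hp as [Hp _]. rewrite <- (firstn_skipn b p), is_path_app in Hp. destruct Hp as [Hp _].
      assert (E : firstn b p = firstn a p ++ skipn a (firstn b p)).
      { rewrite <- (firstn_skipn a (firstn b p)) at 1. now rewrite firstn_firstn, Nat.min_l. }
      rewrite E, is_path_app in Hp. destruct Hp as [_ Hp].
      apply (dist_path HdH) in Hp. rewrite <- last_concat, <- E in Hp.
      rewrite length_skipn, length_firstn in Hp. fold (w a) (w b) in Hp. lia. }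
    pose proof (dist_tri HdH x (w a) (w b)). lia. }
  exists (fun j => f (w j)), (length p). split; [split|split; [|split; [|split]]].
  - intros j Hj. specialize (L2 (w j) (w (1 + j))). rewrite (W j (1 + j)) in L2 by lia.
    replace (1 + j - j) with 1 in L2 by lia. lia.
  - intros a b Hab Hb. now rewrite <- (W a b Hab Hb).
  - reflexivity.
  - unfold w. rewrite firstn_all. destruct Hp as [_ [-> _]]. reflexivity.
  - intros j Hj. exists (w j). split; auto. unfold w.
    destruct (exists_last (l := x :: firstn j p)) as [l [b E]]; [easy|].
    rewrite <- (last_cons x), E, last_last.
    assert (In b (x :: firstn j p)) by (rewrite E; apply in_or_app; simpl; auto).
    destruct H0 as [->|Hb]; [now left|right].
    rewrite <- (firstn_skipn j p). apply in_or_app. auto.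
  - intros v Hv. destruct (in_path_split x v p Hv) as [p1 [p2 [E <-]]].
    exists (length p1). subst p. rewrite length_app. split; [lia|]. f_equal. unfold w.
    now rewrite firstn_app, Nat.sub_diag, firstn_all, app_nil_r.
Qed.

(** From [f v] go to the geodesic of [G] with the same ends ([D2]), across the triangle in [G]
    ([delta]), and to the image of another side ([D1]); the lower bound on [f] pulls the total back
    to [H] at the cost of the factor [M]. *)
Lemma undistorted_hyperbolic {H G : Group} (SH : list H) (SG : list G) dH dG (delta M : nat)
    (f : H -> G) :
  generates SH -> is_dist SH dH -> is_dist SG dG -> slim dG delta ->
  (forall x y, dH x y <= M * dG (f x) (f y)) -> (forall x y, dG (f x) (f y) <= M * dH x y) ->
  hyperbolic H.
Proof.
  intros Gen HdH HdG Hs L1 L2.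
  destruct (geod_near_quasi_geod delta M) as [D1 HD1].
  destruct (quasi_geod_near_geod delta M) as [D2 HD2].
  exists SH, (M * (D2 + delta + D1)). split; auto.
  intros x y z p q r Hp Hq Hr v Hv.
  destruct (geod_quasi_geod HdH f M L1 L2 x p y Hp) as [u [n [U1 [U2 [U3 [U4 U5]]]]]].
  destruct (U5 v Hv) as [j [J1 J2]].
  destruct (HD2 G SG dG HdG Hs u n U1 j J1) as [v1 [V1 V2]].
  rewrite U2, U3 in V1. rewrite J2 in V2.
  destruct (Hs _ _ (f z) v1 V1) as [v2 [V3 V4]].
  assert (Near : forall x' p' y', geodesic SH x' p' y' -> between dG (f x') (f y') v2 ->
    exists w, In w (x' :: p') /\ dist_le SH v w (M * (D2 + delta + D1))).
  { intros x' p' y' Hp' B.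
    destruct (geod_quasi_geod HdH f M L1 L2 x' p' y' Hp') as [u' [n' [U1' [U2' [U3' [U4' _]]]]]].
    rewrite <- U2', <- U3' in B.
    destruct (HD1 G SG dG HdG Hs u' n' U1' v2 B) as [j' [J1' J2']].
    destruct (U4' j' J1') as [w [W1 W2]]. exists w. split; auto. apply HdH.
    specialize (L1 v w). rewrite W2 in J2'.
    pose proof (dist_tri HdG (f v) v1 (f w)). pose proof (dist_tri HdG v1 v2 (f w)). nia. }
  destruct V3 as [V3|V3].
  - destruct (Near y q z Hq V3) as [w [? ?]]. exists w. auto.
  - destruct (Near z r x Hr) as [w [? ?]]; [now apply (between_sym HdG)|]. exists w. auto.
Qed.

(** * Centralizers and the base group *)

Fixpoint ball {G : Group} (S : list G) (n : nat) (x : G) : list G :=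
  match n with
  | 0 => [x]
  | Datatypes.S m =>
      x :: flat_map (ball S m) (map (gmul x) S ++ map (fun s => gmul x (ginv s)) S)
  end.

Lemma in_ball {G : Group} (S : list G) (n : nat) (x y : G) : dist_le S x y n -> In y (ball S n x).
Proof.
  intros [p [P1 [P2 P3]]]. revert x p P1 P2 P3.
  induction n as [|n IH]; intros x [|z p] P1 P2 P3; simpl in P3; try lia; simpl; auto.
  rewrite last_cons in P2. destruct P1 as [[s [Hs E]] P1].
  right. apply in_flat_map. exists z. split; [|apply (IH z p); auto; lia].
  apply in_or_app. destruct E as [->| ->]; [left|right].
  - now apply in_map.
  - now apply (in_map (fun s => gmul x (ginv s))).
Qed.

Lemma infinite_NoDup {H : Group} (K : H -> Prop) : ~ finite_subset K ->
  forall n, exists l : list H, NoDup l /\ length l = n /\ forall k, In k l -> K k.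
Proof.
  intros Inf n. induction n as [|n [l [L1 [L2 L3]]]].
  - exists []. repeat split; auto using NoDup_nil. now simpl.
  - assert (E : exists x, K x /\ ~ In x l).
    { apply NNPP. intros N. apply Inf. exists l. intros k Hk. apply NNPP. eauto. }
    destruct E as [x [Kx Nx]]. exists (x :: l). repeat split.
    + now constructor.
    + simpl. now rewrite L2.
    + intros k [<-|Hk]; auto.
Qed.

Lemma NoDup_prod {X Y : Type} (l : list X) (l' : list Y) :
  NoDup l -> NoDup l' -> NoDup (list_prod l l').
Proof.
  intros Hl Hl'. induction Hl as [|x l Nx Hl IH]; simpl; [constructor|].
  apply NoDup_app; auto.
  - apply NoDup_map_NoDup_ForallPairs; auto. intros a b _ _ E. now injection E.
  - intros [a b] Hab Hab'. apply in_map_iff in Hab. destruct Hab as [y [E _]].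
    injection E as -> ->. apply in_prod_iff in Hab'. easy.
Qed.

Lemma dist_gpow {G : Group} {S : list G} {d} (Hd : is_dist S d) (c : G) (n : nat) :
  d gone (gpow c n) <= n * d gone c.
Proof.
  induction n as [|n IH]; simpl; [now rewrite (dist_refl Hd)|].
  pose proof (dist_tri Hd gone c (gmul c (gpow c n))) as T.
  rewrite (dist_mul1 Hd) in T. lia.
Qed.

(* Each [f k * c^p] moves the point [m] of a long geodesic from [1] to [c^n] close to that
   geodesic.  There are too many of these elements: their number is the product of the
   ranges of [k] and [p], while the room on the geodesic is linear in [p]. *)
Lemma hyperbolic_centralizer_finite {H G : Group} (K : H -> Prop) (f : H -> G) (c : G) :
  hyperbolic G ->
  (forall k, K k -> gmul c (f k) = gmul (f k) c) ->
  (forall k k' p q, gmul (f k) (gpow c p) = gmul (f k') (gpow c q) -> k = k' /\ p = q) ->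
  finite_subset K.
Proof.
  intros [S [delta [Gen Hyp]]] Comm Inj. apply NNPP. intros Inf.
  destruct (dist_exists S Gen) as [d Hd].
  set (B := ball S (2 * delta) gone). set (b := length B). set (C := d gone c).
  destruct (infinite_NoDup K Inf (2 * C * b + 1)) as [lk [Nlk [Llk Klk]]].
  set (L := list_max (map (fun k => d gone (f k)) lk)).
  assert (HL : forall k, In k lk -> d gone (f k) <= L).
  { intros k Hk. pose proof (proj1 (list_max_le (map (fun k => d gone (f k)) lk) L)
      (Nat.le_refl _)) as FA. rewrite Forall_forall in FA. apply FA.
    now apply (in_map (fun k => d gone (f k))). }
  (* [R] bounds the length of [f k * c^p] for [p <= P], and [X] exceeds [R + 2 delta]. [P] is chosen
     so that [2 X b = 2 C b P + P], which is less than the number [(2 C b + 1) (P + 1)] of pairs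
     [(k, p)]. *)
  set (P := (2 * L + 4 * delta + 2) * b). set (R := P * C + L). set (X := 2 * delta + R + 1).
  assert (Commn : forall k n, K k -> gmul (gpow c n) (f k) = gmul (f k) (gpow c n)).
  { intros k n Hk. induction n as [|n IH]; simpl; [now grp|].
    rewrite <- gassoc, IH, !gassoc, Comm; auto. }
  assert (Cpow : forall p q, gmul (gpow c p) (gpow c q) = gmul (gpow c q) (gpow c p)).
  { assert (C1 : forall q, gmul c (gpow c q) = gmul (gpow c q) c).
    { induction q as [|q IH]; simpl; [now grp|]. now rewrite <- gassoc, <- IH. }
    intros p q. induction p as [|p IH]; simpl; [now grp|].
    now rewrite <- gassoc, IH, !gassoc, C1. }
  (* The powers of [c] are pairwise distinct, so they do not all fit into a finite ball. *)
  assert (Far : exists n, 2 * X <= d gone (gpow c n)).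
  { apply NNPP. intros N.
    set (l := map (gpow c) (seq 0 (1 + length (ball S (2 * X) gone)))).
    assert (Hl : length l <= length (ball S (2 * X) gone)).
    { apply NoDup_incl_length.
      - apply NoDup_map_NoDup_ForallPairs; [|apply seq_NoDup]. intros p q _ _ E.
        apply (Inj gone gone). now rewrite E.
      - intros g Hg. apply in_map_iff in Hg. destruct Hg as [p [<- _]].
        apply in_ball, Hd. apply not_lt. intros Q. apply N. exists p. lia. }
    unfold l in Hl. rewrite length_map, length_seq in Hl. lia. }
  destruct Far as [n Hn]. set (z := gpow c n) in *.
  destruct (dist_geod Hd gone z) as [sg [Hsg Lsg]].
  destruct (between_geod Hd gone z sg Hsg (firstn X sg) (skipn X sg)) as [M1 M2].
  { now rewrite firstn_skipn. }
  set (m := last (firstn X sg) gone) in *.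
  rewrite length_firstn in M1. rewrite length_skipn in M2.
  (* As [a] commutes with [z], it carries the geodesic from [1] to [z] to one from [a] to [z a],
     with ends moved by at most [R]. The point [a m] is at least [X > R + 2 delta] from both [a] and
     [a z], so in the quadrilateral it can only be close to [sg]. *)
  assert (Close : forall a, gmul z a = gmul a z -> d gone a <= R ->
    exists w, In w (gone :: sg) /\ d (gmul a m) w <= 2 * delta).
  { intros a Ca Ha.
    assert (Haz : d (gmul a z) z <= R).
    { rewrite <- Ca. now rewrite (dist_sym Hd), (dist_mul1 Hd). }
    destruct (dist_geod Hd (gmul a z) gone) as [q [Hq _]].
    destruct (dist_geod Hd gone a) as [r [Hr Lr]].
    destruct (dist_geod Hd z (gmul a z)) as [r' [Hr' Lr']].
    destruct (dist_geod Hd (gmul a gone) (gmul a m)) as [p1 [Hp1 Lp1]].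
    destruct (dist_geod Hd (gmul a m) (gmul a z)) as [p2 [Hp2 Lp2]].
    rewrite (dist_mul Hd) in Lp1, Lp2. rewrite gone_r in Hp1.
    destruct Hp1 as [P1 [P2 _]]. destruct Hp2 as [P3 [P4 _]].
    assert (Hp : geodesic S a (p1 ++ p2) (gmul a z)).
    { apply (geod_length Hd). rewrite is_path_app, last_concat, length_app, P2, Lp1, Lp2.
      repeat split; auto. rewrite (dist_mul1 Hd). lia. }
    assert (Hv : In (gmul a m) (a :: p1 ++ p2)).
    { destruct (exists_last (l := a :: p1)) as [l' [v E]]; [easy|].
      rewrite app_comm_cons, E. rewrite <- (last_cons a), E, last_last in P2.
      apply in_or_app. left. apply in_or_app. right. left. exact P2. }
    assert (Dam : d a (gmul a m) = X).
    { rewrite (dist_mul1 Hd). lia. }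
    assert (Dmz : X <= d (gmul a m) (gmul a z)) by (rewrite (dist_mul Hd); lia).
    destruct (Hyp _ _ _ _ _ _ Hp Hq Hr _ Hv) as [w [[Hw|Hw] Vw]]; apply Hd in Vw.
    - destruct (Hyp _ _ _ _ _ _ Hq Hsg Hr' _ Hw) as [w' [[Hw'|Hw'] Vw']]; apply Hd in Vw';
        pose proof (dist_tri Hd (gmul a m) w w').
      + exists w'. split; auto. lia.
      + exfalso. apply (in_geod_between Hd _ _ _ _ Hr') in Hw'. unfold between in Hw'.
        rewrite (dist_sym Hd z (gmul a z)) in Hw'.
        pose proof (dist_tri Hd (gmul a m) w' (gmul a z)). lia.
    - exfalso. apply (in_geod_between Hd _ _ _ _ Hr) in Hw. unfold between in Hw.
      pose proof (dist_tri Hd (gmul a m) w a). rewrite (dist_sym Hd (gmul a m) a) in *. lia. }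
  set (A := map (fun kp => gmul (gmul (f (fst kp)) (gpow c (snd kp))) m)
    (list_prod lk (seq 0 (1 + P)))).
  (* The products [f k * c^p * m] are distinct, and each is a vertex among the first [2 X] of [sg]
     times an element of [B]. *)
  assert (HA : length A <= length (map (fun wb => gmul (fst wb) (snd wb))
      (list_prod (firstn (2 * X) (gone :: sg)) B))).
  { apply NoDup_incl_length.
    - apply NoDup_map_NoDup_ForallPairs; [|apply NoDup_prod; auto using seq_NoDup].
      intros [k p] [k' p'] _ _ E. apply gcancel_r in E. apply Inj in E. simpl in E.
      now destruct E as [-> ->].
    - intros g Hg. apply in_map_iff in Hg. destruct Hg as [[k p] [<- Hkp]]. simpl.
      apply in_prod_iff in Hkp. destruct Hkp as [Hk Hp]. apply in_seq in Hp.
      assert (HaR : d gone (gmul (f k) (gpow c p)) <= R).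
      { pose proof (dist_tri Hd gone (f k) (gmul (f k) (gpow c p))) as T.
        rewrite (dist_mul1 Hd) in T.
        pose proof (dist_gpow Hd c p). specialize (HL k Hk).
        assert (p * C <= P * C) by (apply Nat.mul_le_mono_r; lia). unfold R. fold C in H0. lia. }
      destruct (Close (gmul (f k) (gpow c p))) as [w [Hw Dw]]; auto.
      { unfold z. rewrite gassoc, Commn by auto. rewrite <- !gassoc. f_equal. apply Cpow. }
      set (a := gmul (f k) (gpow c p)) in *.
      apply in_map_iff. exists (w, gmul (ginv w) (gmul a m)). split; [simpl; now grp|].
      apply in_prod.
      + destruct (in_path_split gone w sg Hw) as [p1 [p2 [E Ew]]].
        destruct (between_geod Hd gone z sg Hsg p1 p2 E) as [E1 _]. rewrite Ew in E1.
        (* The distance from [1] to [w] is at most [R + X + 2 delta], that is [2 X - 1]. *)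
        assert (Hlen : length p1 < 2 * X).
        { pose proof (dist_tri Hd gone (gmul a m) w). pose proof (dist_tri Hd gone a (gmul a m)).
          assert (d a (gmul a m) = X).
          { rewrite (dist_mul1 Hd). lia. }
          unfold X in *. lia. }
        rewrite E. rewrite app_comm_cons.
        destruct (exists_last (l := gone :: p1)) as [l' [v Ev]]; [easy|].
        rewrite <- (last_cons gone), Ev, last_last in Ew. subst v.
        assert (Hl' : length (gone :: p1) = length l' + 1) by now rewrite Ev, length_app.
        simpl in Hl'.
        rewrite firstn_app. apply in_or_app. left. rewrite firstn_all2 by (simpl; lia).
        rewrite Ev. apply in_or_app. simpl. auto.
      + apply in_ball, Hd. rewrite <- (ginv_l _ w), (dist_mul Hd), (dist_sym Hd). exact Dw. }
  unfold A in HA. rewrite !length_map, !length_prod, length_seq, Llk in HA. fold b in HA.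
  pose proof (firstn_le_length (2 * X) (gone :: sg)).
  pose proof (length_firstn (2 * X) (gone :: sg)).
  assert (Hb : (2 * C * b + 1) * (1 + P) <= 2 * X * b).
  { eapply Nat.le_trans; [exact HA|]. apply Nat.mul_le_mono_r. lia. }
  assert (E1 : 2 * X * b = 2 * P * C * b + P) by (unfold X, R, P; ring).
  assert (E2 : (2 * C * b + 1) * (1 + P) = 2 * P * C * b + P + 2 * C * b + 1) by ring.
  lia.
Qed.

Lemma adj_retract {G H : Group} (S : list G) (S' : list H) (p : G -> H) :
  (forall s, In s S -> forall g, In (gmul (ginv (p g)) (p (gmul g s))) S') ->
  forall x y, adj S x y -> adj S' (p x) (p y).
Proof.
  intros HS x y [s [Hs E]].
  assert (Main : forall g, adj S' (p g) (p (gmul g s))).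
  { intros g. exists (gmul (ginv (p g)) (p (gmul g s))). split; auto. left. now grp. }
  destruct E as [->| ->]; [apply Main|]. apply adj_sym.
  specialize (Main (gmul x (ginv s))). now rewrite gmulVK in Main.
Qed.

Lemma finite_choice {X Y : Type} (Q : X -> list Y -> Prop) (l : list X) :
  (forall x l1 l2, incl l1 l2 -> Q x l1 -> Q x l2) ->
  (forall x, exists T, Q x T) -> exists T, forall x, In x l -> Q x T.
Proof.
  intros Mono Ex. induction l as [|x l [T HT]]; [now exists []|].
  destruct (Ex x) as [T' HT']. exists (T' ++ T). intros y [<-|Hy].
  - apply (Mono x T'); auto. now apply incl_appl, incl_refl.
  - apply (Mono y T); auto. now apply incl_appr, incl_refl.
Qed.

(** Take as [S'] all differences that the coarse retraction [p] produces along generators of [G].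
    Then [p] maps edges to edges: images of paths show that [S'] generates [H] and that distances in
    [H] are at most those in [G]. The converse bound uses the longest [i s] with [s] in [S']. *)
Lemma HNN_base_hyperbolic {H : Group} {K : H -> Prop} {phi : H -> H} {G : Group}
    {i : H -> G} {t : G} :
  is_HNN K phi i t -> is_aut phi -> is_subgroup K -> finite_subset K -> hyperbolic G ->
  hyperbolic H.
Proof.
  intros HNN Ha HK FK [S [delta [Gen Hyp]]].
  destruct (HNN_coarse_retraction HNN Ha HK FK) as [p [Pi PT]].
  pose proof HNN as [Hi _].
  destruct (finite_choice (fun s T => forall g, In (gmul (ginv (p g)) (p (gmul g s))) T) S)
    as [S' HS'].
  - intros s l1 l2 Hl HQ g. auto.
  - exact PT.
  - pose proof (adj_retract S S' p HS') as Hadj.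
    assert (Gen' : generates S').
    { intros h. destruct (Gen (i h)) as [q [Q1 Q2]].
      assert (P1 : p gone = gone) by (rewrite <- (hom_one i Hi); apply Pi).
      exists (map p q). rewrite <- P1. split; [now apply (is_path_map S S')|].
      now rewrite last_map, Q2, Pi. }
    destruct (dist_exists S Gen) as [dG HdG]. destruct (dist_exists S' Gen') as [dH HdH].
    set (M0 := list_max (map (fun s => dG gone (i s)) S')).
    assert (HM0 : forall s, In s S' -> dG gone (i s) <= M0).
    { intros s Hs. pose proof (proj1 (list_max_le (map (fun s => dG gone (i s)) S') M0)
        (Nat.le_refl _)) as FA. rewrite Forall_forall in FA. apply FA.
      now apply (in_map (fun s => dG gone (i s))). }
    apply (undistorted_hyperbolic S' S dH dG delta (1 + M0) i Gen' HdH HdG).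
    + now apply (hyperbolic_slim HdG).
    + intros x y. enough (dH x y <= dG (i x) (i y)) by lia.
      destruct (dist_geod HdG (i x) (i y)) as [q [[Q1 [Q2 _]] <-]].
      pose proof (is_path_map S S' p Hadj q (i x) Q1) as P1.
      pose proof (last_map p (i x) q) as P2. rewrite Q2, !Pi in P2. rewrite Pi in P1.
      rewrite <- (length_map p), <- P2. now apply (dist_path HdH).
    + intros x y. destruct (dist_geod HdH x y) as [q [[Q1 [Q2 _]] <-]].
      revert x Q1 Q2. induction q as [|z q IH]; intros x Q1 Q2.
      * simpl in Q2. subst y. rewrite (dist_refl HdG). lia.
      * rewrite last_cons in Q2. destruct Q1 as [[s [Hs E]] Q1]. specialize (IH z Q1 Q2).
        pose proof (dist_tri HdG (i x) (i z) (i y)).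
        assert (dG (i x) (i z) <= M0).
        { specialize (HM0 s Hs). destruct E as [->| ->]; rewrite Hi.
          - rewrite <- (gone_r (i x)) at 1. now rewrite (dist_mul HdG).
          - rewrite <- (gone_r (i x)) at 1. rewrite (dist_mul HdG), (hom_inv i s Hi).
            rewrite <- (dist_mul HdG (i s)), gone_r, ginv_r, (dist_sym HdG). exact HM0. }
        simpl length. lia.
Qed.

(** * Residual finiteness *)

Definition finite (X : Type) : Prop := exists l : list X, forall x, In x l.

Lemma finite_inj {X Y : Type} (f : X -> Y) (l : list Y) :
  (forall x y, f x = f y -> x = y) -> (forall x, In (f x) l) -> finite X.
Proof.
  intros Inj Hl.
  assert (E : exists l', forall x, In (f x) l -> In x l').
  { clear Hl. induction l as [|y l [l' IH]]; [now exists []|].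
    destruct (classic (exists x, f x = y)) as [[x <-]|N].
    - exists (x :: l'). intros x' [E|Hx']; [left; auto|right; auto].
    - exists l'. intros x [E|Hx]; auto. exfalso. eauto. }
  destruct E as [l' Hl']. exists l'. auto.
Qed.

Lemma finite_prod {X Y : Type} : finite X -> finite Y -> finite (X * Y).
Proof.
  intros [l Hl] [l' Hl']. exists (list_prod l l'). intros [x y]. apply in_prod; auto.
Qed.

Lemma finite_lists {X : Type} (n : nat) : finite X ->
  exists L : list (list X), forall l, length l = n -> In l L.
Proof.
  intros [lX HX]. induction n as [|n [L HL]].
  - exists [[]]. intros [|]; simpl; auto. discriminate.
  - exists (map (fun z => fst z :: snd z) (list_prod lX L)).
    intros [|x l] E; [discriminate|]. injection E as E.
    apply (in_map (fun z => fst z :: snd z) _ (x, l)), in_prod; auto.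
Qed.

Lemma finite_fun {X Y : Type} : finite X -> finite Y -> finite (X -> Y).
Proof.
  intros [lX HX] HY. destruct (finite_lists (length lX) HY) as [L HL].
  apply (finite_inj (fun f => map f lX) L); [|intros f; apply HL, length_map].
  intros f g E. apply functional_extensionality. intros x.
  eapply ext_in_map; eauto.
Qed.

Lemma finite_Sym {X : Type} : finite X -> finite_group (Sym X).
Proof.
  intros HX. destruct (finite_fun HX HX) as [l Hl].
  change (finite (perm X)). apply (finite_inj pfun l); auto.
  intros p q E. apply perm_ext. intros x. now rewrite E.
Qed.

(** A homomorphism is determined by its values on the generators. *)
Lemma finite_homs {H F : Group} (S : list H) : generates S -> finite_group F ->
  finite {f : H -> F | is_hom f}.
Proof.
  intros Gen HF. destruct (finite_lists (length S) HF) as [L HL].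
  apply (finite_inj (fun f => map (proj1_sig f) S) L); [|intros f; apply HL, length_map].
  intros [f Hf] [g Hg] E. apply subset_eq_compat. simpl in E.
  apply functional_extensionality. intros x. destruct (Gen x) as [p [P1 <-]].
  assert (E1 : f gone = g gone) by now rewrite (hom_one f), (hom_one g).
  revert P1 E1. generalize (@gone H). induction p as [|y p IH]; intros z P1 E1; [easy|].
  rewrite last_cons. destruct P1 as [[s [Hs Es]] P1]. apply IH; auto.
  assert (E2 : f s = g s) by (eapply ext_in_map; eauto).
  destruct Es as [->| ->]; rewrite Hf, Hg, ?(hom_inv f), ?(hom_inv g) by easy; congruence.
Qed.

Definition prod_group (A B : Group) : Group.
Proof.
  refine {| gcar := A * B;
    gmul := fun x y => (gmul (fst x) (fst y), gmul (snd x) (snd y));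
    gone := (gone, gone);
    ginv := fun x => (ginv (fst x), ginv (snd x)) |}.
  - intros [] [] []. simpl. now rewrite !gassoc.
  - intros []. simpl. now rewrite !gone_l.
  - intros []. simpl. now rewrite !ginv_l.
Defined.

Lemma residually_finite_list {H : Group} : residually_finite H -> forall l : list H,
  exists (F : Group) (f : H -> F), finite_group F /\ is_hom f /\
    forall a, In a l -> a <> gone -> f a <> gone.
Proof.
  intros RF l. induction l as [|a l [F [f [FF [Hf Sf]]]]].
  - exists (Sym unit), (fun _ => gone). split; [|split; [|easy]].
    + apply finite_Sym. exists [tt]. intros []. now left.
    + intros x y. now rewrite gone_l.
  - destruct (classic (a = gone)) as [->|Na].
    + exists F, f. repeat split; auto. intros b [<-|Hb]; auto.
    + destruct (RF a Na) as [F' [f' [FF' [Hf' Sf']]]].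
      exists (prod_group F' F), (fun x => (f' x, f x)). split; [|split].
      * exact (finite_prod FF' FF).
      * intros x y. simpl. now rewrite Hf, Hf'.
      * intros b [<-|Hb] Nb E; injection E as E1 E2; auto. now apply (Sf b).
Qed.

(** * Reduced words in the HNN extension *)

Fixpoint wval {H G : Group} (i : H -> G) (t : G) (w : list (bool * H)) : G :=
  match w with
  | [] => gone
  | (e, h) :: w' => gmul (gmul (if e : bool then t else ginv t) (i h)) (wval i t w')
  end.

(** Excluded are [t h t^-1] with [h] in [K] and [t^-1 h t] with [h] in [phi(K)]; the latter
    membership is written [K (psi h)]. *)
Fixpoint reduced {H : Group} (K : H -> Prop) (psi : H -> H) (w : list (bool * H)) : Prop :=
  match w with
  | [] => True
  | (e, h) :: w' =>
      match w' with
      | [] => True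
      | (e', _) :: _ => e <> e' -> ~ K (if e : bool then h else psi h)
      end /\ reduced K psi w'
  end.

Lemma HNN_words {H : Group} {K : H -> Prop} {phi : H -> H} {G : Group} {i : H -> G} {t : G} :
  is_HNN K phi i t -> forall g, exists h w, g = gmul (i h) (wval i t w).
Proof.
  intros HNN. pose proof HNN as [Hi _].
  set (W := fun g => exists h w, g = gmul (i h) (wval i t w)).
  (* The induction concerns stability of [W] under left multiplication by [x] and [x^-1], a property
     that passes to products and inverses directly. *)
  assert (M : forall x, (forall g, W g -> W (gmul x g)) /\ (forall g, W g -> W (gmul (ginv x) g))).
  { apply (HNN_ind (fun x => (forall g, W g -> W (gmul x g)) /\
      (forall g, W g -> W (gmul (ginv x) g))) HNN).
    - intros h. split; intros g [h0 [w ->]].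
      + exists (gmul h h0), w. rewrite Hi. now grp.
      + exists (gmul (ginv h) h0), w. rewrite Hi, (hom_inv i) by easy. now grp.
    - split; intros g [h0 [w ->]].
      + exists gone, ((true, h0) :: w). rewrite (hom_one i) by easy. simpl. now grp.
      + exists gone, ((false, h0) :: w). rewrite (hom_one i) by easy. simpl. now grp.
    - intros x y [X1 X2] [Y1 Y2]. split; intros g Wg.
      + rewrite <- gassoc. auto.
      + rewrite ginv_mul, <- gassoc. auto.
    - intros x [X1 X2]. rewrite ginv_inv. auto. }
  intros g. rewrite <- (gone_r g). apply M. exists gone, []. simpl.
  now rewrite (hom_one i), gone_r.
Qed.

(** A subword [t h t^-1] or [t^-1 h t] violating [reduced] is replaced by [phi h] or [psi h],
    absorbed into the neighbouring elements of [H]. *)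
Lemma shorten_word {H : Group} {K : H -> Prop} {phi psi : H -> H} {G : Group}
    {i : H -> G} {t : G} :
  is_HNN K phi i t -> (forall x, phi (psi x) = x) ->
  forall w h, ~ reduced K psi w ->
  exists h' w', length w' < length w /\
    gmul (i h) (wval i t w) = gmul (i h') (wval i t w').
Proof.
  intros [Hi [Ht _]] E w. induction w as [|[e h] w IH]; intros h0 N; [now contradiction N|].
  destruct (classic (reduced K psi w)) as [R|R].
  - destruct w as [|[e' h'] w]; [now contradiction N|].
    assert (N' : e <> e' /\ K (if e then h else psi h)).
    { apply NNPP. intros Q. apply N. split; auto. }
    destruct N' as [Ne Kh].
    exists (gmul (gmul h0 (if e then phi h else psi h)) h'), w. split; [simpl; lia|].
    rewrite !Hi. destruct e, e'; try easy; simpl.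
    + rewrite <- (Ht h Kh). now grp.
    + specialize (Ht (psi h) Kh). rewrite E in Ht. rewrite <- Ht. now grp.
  - destruct (IH h R) as [h' [w' [L Ew]]]. exists h0, ((e, h') :: w'). split; [simpl; lia|].
    simpl. rewrite <- !gassoc. now rewrite Ew.
Qed.

Lemma HNN_reduced_words {H : Group} {K : H -> Prop} {phi psi : H -> H} {G : Group}
    {i : H -> G} {t : G} :
  is_HNN K phi i t -> (forall x, phi (psi x) = x) ->
  forall g, exists h w, reduced K psi w /\ g = gmul (i h) (wval i t w).
Proof.
  intros HNN E g.
  destruct (nat_least (fun n => exists h w, length w = n /\ g = gmul (i h) (wval i t w)))
    as [n [[h [w [Ln Eg]]] Min]].
  - destruct (HNN_words HNN g) as [h [w Eg]]. eauto.
  - exists h, w. split; auto. apply NNPP. intros N.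
    destruct (shorten_word HNN E w h N) as [h' [w' [L Ew]]].
    specialize (Min (length w')). enough (n <= length w') by lia. apply Min.
    exists h', w'. split; congruence.
Qed.

(** * Permutations realizing a reduced word as a walk *)

Definition transpose {J : Type} (a b x : J) : J :=
  if excluded_middle_informative (x = a) then b
  else if excluded_middle_informative (x = b) then a else x.

Lemma transposeK {J : Type} (a b x : J) : transpose a b (transpose a b x) = x.
Proof.
  unfold transpose.
  repeat (destruct excluded_middle_informative; subst; try easy).
Qed.

Definition transpose_perm {J : Type} (a b : J) : perm J :=
  Perm J (transpose a b) (transpose a b) (transposeK a b) (transposeK a b).

Lemma transpose_l {J : Type} (a b : J) : transpose a b a = b.
Proof. unfold transpose. now destruct excluded_middle_informative. Qed.

Lemma transpose_r {J : Type} (a b : J) : transpose a b b = a.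
Proof.
  unfold transpose. repeat (destruct excluded_middle_informative; subst; try easy).
Qed.

Lemma transpose_other {J : Type} (a b x : J) : x <> a -> x <> b -> transpose a b x = x.
Proof. intros. unfold transpose. now repeat destruct excluded_middle_informative. Qed.

(** These are the reduced words of the free group on [C], with the boolean as the sign of the
    exponent. *)
Fixpoint conflict_free {C : Type} (cs : list (bool * C)) : Prop :=
  match cs with
  | [] => True
  | (e, c) :: cs' =>
      match cs' with
      | [] => True
      | (e', c') :: _ => e <> e' -> c <> c'
      end /\ conflict_free cs'
  end.

(** Read from the right, the letter number [n] of [cs] moves [p n] to [p (1 + n)]. *)
Fixpoint walk {C J : Type} (p : nat -> J) (sigma : C -> perm J) (cs : list (bool * C)) : Prop :=
  match cs with
  | [] => True
  | (e, c) :: cs' => walk p sigma cs' /\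
      (if e : bool then sigma c (p (length cs')) = p (1 + length cs')
       else sigma c (p (1 + length cs')) = p (length cs'))
  end.

Lemma walk_ext {C J : Type} (p : nat -> J) (sigma sigma' : C -> perm J) (cs : list (bool * C)) :
  (forall c a b, a <= length cs -> b <= length cs -> sigma c (p a) = p b -> sigma' c (p a) = p b) ->
  walk p sigma cs -> walk p sigma' cs.
Proof.
  induction cs as [|[e c] cs IH]; intros Hs; [easy|]. intros [W1 W2]. split.
  - apply IH; auto. intros. apply Hs; simpl; auto.
  - destruct e; apply Hs; simpl; auto.
Qed.

(* Residual finiteness of free groups: the steps of a reduced word prescribe a partial
   injection for each letter; it is extended to a permutation one transposition at a time. *)
Lemma conflict_free_walk {C J : Type} (p : nat -> J) (N : nat) (cs : list (bool * C)) :
  (forall a b, a <= N -> b <= N -> p a = p b -> a = b) -> length cs <= N -> conflict_free cs ->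
  exists sigma : C -> perm J,
    (forall c j, length cs < j -> j <= N -> sigma c (p j) = p j) /\ walk p sigma cs.
Proof.
  intros Inj. induction cs as [|[e c] cs IH]; intros HN CF.
  - exists (fun _ => pid J). now split.
  - simpl in HN. destruct CF as [CF1 CF2]. destruct IH as [sigma [S1 S2]]; [lia|easy|].
    set (n := length cs) in *.
    (* So far [sigma c] fixes the unvisited point [p (1 + n)]. Composing with [s], before or after
       according to [e], yields the new step. *)
    set (s := transpose_perm (p n) (p (1 + n))).
    assert (Sn : s (p n) = p (1 + n)) by apply transpose_l.
    assert (Sn1 : s (p (1 + n)) = p n) by apply transpose_r.
    assert (So : forall j, j <= N -> j <> n -> j <> 1 + n -> s (p j) = p j).
    { intros j Hj J1 J2. apply transpose_other; intros Q; apply Inj in Q; auto; lia. }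
    clearbody s. exists (fun x => if excluded_middle_informative (x = c) then
      (if e then pcomp (sigma c) s else pcomp s (sigma c)) else sigma x).
    split; [|split].
    + intros x j J1 J2. simpl in J1. fold n in J1.
      destruct (excluded_middle_informative (x = c)); [|apply S1; lia].
      destruct e; simpl.
      * rewrite So by lia. apply S1; lia.
      * rewrite S1 by lia. apply So; lia.
    + destruct cs as [|[e' c'] cs]; [exact I|]. simpl in n. destruct S2 as [S2 S3].
      cbv beta in *.
      (* All steps but the latest only involve points of index below [n], which [s] fixes. *)
      split; [revert S2; apply walk_ext|].
      * intros x a b Ha Hb Q. destruct (excluded_middle_informative (x = c)) as [->|]; auto.
        destruct e; simpl.
        -- rewrite So by lia. exact Q.
        -- rewrite Q. apply So; lia.
      * destruct (excluded_middle_informative (c' = c)) as [->|]; auto.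
        (* The latest step also touches [p n]. If it has the same letter, it has the same direction,
           so [s] only acts on the side where [p n] does not occur. *)
        assert (e = e') by (apply NNPP; intros Q; now apply (CF1 Q)). subst e'.
        destruct e; simpl.
        -- rewrite So by lia. exact S3.
        -- simpl in S3. rewrite S3. apply So; lia.
    + fold n. destruct (excluded_middle_informative (c = c)); [|easy].
      destruct e; simpl.
      * rewrite Sn. apply S1; lia.
      * change (Datatypes.S n) with (1 + n). rewrite (S1 c (1 + n)) by lia. exact Sn1.
Qed.

Fixpoint track {H : Group} {X : Type} (act : H -> X -> X) (tau : perm X) (x : X)
    (w : list (bool * H)) : X :=
  match w with
  | [] => x
  | (e, h) :: w' => (if e : bool then pfun tau else pinv tau) (act h (track act tau x w'))
  end.

(** The free-group word that [w] induces on the second factor: [t] at [y] applies the letter [r y],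
    and [t^-1] at [y] undoes the letter applied at [tau^-1 y]. *)
Fixpoint colors {H : Group} {X : Type} (act : H -> X -> X) (tau : perm X) (r : X -> X) (x : X)
    (w : list (bool * H)) : list (bool * X) :=
  match w with
  | [] => []
  | (e, h) :: w' =>
      let y := act h (track act tau x w') in
      (e, r (if e : bool then y else pinv tau y)) :: colors act tau r x w'
  end.

Lemma length_colors {H : Group} {X : Type} (act : H -> X -> X) (tau : perm X) (r : X -> X) (x : X)
    (w : list (bool * H)) : length (colors act tau r x w) = length w.
Proof. induction w as [|[e h] w IH]; simpl; auto. Qed.

(** Around [t h t^-1] the two letters are [r (h y)] and [r y]; around [t^-1 h t] they are
    [r (psi h y)] and [r y]. Reducedness puts [h], respectively [psi h], outside [K], where the
    separation hypothesis applies. *)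
Lemma colors_conflict_free {H : Group} (K : H -> Prop) (phi psi : H -> H) {X : Type}
    (act : H -> X -> X) (tau : perm X) (r : X -> X) (x : X) (w : list (bool * H)) :
  (forall y, phi (psi y) = y) -> (forall h y, tau (act h y) = act (phi h) (tau y)) ->
  (forall e h g, In (e, h) w -> g = h \/ g = psi h -> ~ K g -> forall y, r (act g y) <> r y) ->
  reduced K psi w -> conflict_free (colors act tau r x w).
Proof.
  intros E Ht Sep. induction w as [|[e h] w IH]; [easy|]. intros [R1 R2]. split.
  - destruct w as [|[e' h'] w]; [easy|]. intros Ne. specialize (R1 Ne).
    destruct e, e'; try easy; simpl.
    + apply (Sep true h); simpl; auto.
    + set (y := act h' _).
      replace (pinv tau (act h (tau y))) with (act (psi h) y).
      * apply (Sep false h); simpl; auto.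
      * rewrite <- (pfunK tau (act (psi h) y)), Ht, E. reflexivity.
  - apply IH; auto. intros e' h' g Hin. apply (Sep e' h' g). now right.
Qed.

Lemma wval_walk {H G : Group} (i : H -> G) (t : G) {X J : Type} (act : H -> X -> X)
    (tau : perm X) (r : X -> X) (p : nat -> J) (sigma : X -> perm J) (Phi : G -> Sym (X * J))
    (x0 : X) (w : list (bool * H)) :
  is_hom Phi ->
  (forall h x j, pfun (Phi (i h)) (x, j) = (act h x, j)) ->
  (forall x j, pfun (Phi t) (x, j) = (tau x, sigma (r x) j)) ->
  (forall x j, pfun (Phi (ginv t)) (x, j) = (pinv tau x, pinv (sigma (r (pinv tau x))) j)) ->
  walk p sigma (colors act tau r x0 w) ->
  pfun (Phi (wval i t w)) (x0, p 0) = (track act tau x0 w, p (length w)).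
Proof.
  intros Ph Pi Pt Pv. induction w as [|[e h] w IH]; intros Wk; simpl.
  - now rewrite (hom_one Phi Ph).
  - destruct Wk as [W1 W2]. rewrite length_colors in W2. rewrite !Ph. simpl.
    rewrite (IH W1), Pi. destruct e.
    + rewrite Pt. f_equal. exact W2.
    + rewrite Pv. f_equal. rewrite <- W2. apply pfunK.
Qed.

(** [phi] need not descend to the finite quotient [F], but it acts on [Hom(H, F)] by precomposition.
    Functions [Hom(H, F) -> F] thus carry compatible actions of [H] and [phi]. *)
Lemma HNN_residually_finite {H : Group} {K : H -> Prop} {phi : H -> H} {G : Group}
    {i : H -> G} {t : G} (S : list H) :
  is_HNN K phi i t -> is_aut phi -> is_subgroup K -> finite_subset K -> generates S ->
  residually_finite H -> residually_finite G.
Proof.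
  intros HNN Ha HK [lK HlK] Gen RF g Ng.
  destruct (aut_inverse phi Ha) as [psi [Hpsi [E1 E2]]].
  destruct (HNN_reduced_words HNN E2 g) as [h0 [w [Rw Eg]]].
  (* For [a] outside [K], with [a] of the form [h] or [psi h] for a letter [h], no product [k a]
     with [k] in [K] is trivial; [f] keeps these products nontrivial, and [h0] as well. *)
  destruct (residually_finite_list RF (h0 :: flat_map (fun k => flat_map
    (fun eh => [gmul k (snd eh); gmul k (psi (snd eh))]) w) lK)) as [F [f [FF [Hf Sf]]]].
  (* As [H] is finitely generated, [Homs] is finite; [phi] acts on it by composition. *)
  set (Homs := {f : H -> F | is_hom f}).
  set (X := Homs -> F).
  set (act := fun (h : H) (x : X) => (fun f => gmul (proj1_sig f h) (x f)) : X).
  assert (Hcomp : forall (f : H -> F) (a : H -> H), is_hom f -> is_hom a ->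
    is_hom (fun x => f (a x))) by (intros f' a Q1 Q2 x y; now rewrite Q2, Q1).
  set (pull := fun (a : H -> H) (Qa : is_hom a) (f : Homs) =>
    exist _ (fun x => proj1_sig f (a x)) (Hcomp _ a (proj2_sig f) Qa) : Homs).
  assert (Hphi : is_hom phi) by now destruct Ha.
  assert (T1 : forall x : X, (fun f => x (pull phi Hphi (pull psi Hpsi f))) = x).
  { intros x. apply functional_extensionality. intros [f' Hf']. f_equal.
    apply subset_eq_compat. simpl. apply functional_extensionality. intros y. now rewrite E1. }
  assert (T2 : forall x : X, (fun f => x (pull psi Hpsi (pull phi Hphi f))) = x).
  { intros x. apply functional_extensionality. intros [f' Hf']. f_equal.
    apply subset_eq_compat. simpl. apply functional_extensionality. intros y. now rewrite E2. }
  set (tau := Perm X (fun x f => x (pull phi Hphi f)) (fun x f => x (pull psi Hpsi f)) T1 T2).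
  assert (A1 : forall x, act gone x = x).
  { intros x. apply functional_extensionality. intros f'. unfold act.
    rewrite (hom_one _ (proj2_sig f')). now grp. }
  assert (AM : forall a b x, act (gmul a b) x = act a (act b x)).
  { intros a b x. apply functional_extensionality. intros f'. unfold act.
    rewrite (proj2_sig f'). now grp. }
  assert (Ht : forall h x, tau (act h x) = act (phi h) (tau x)) by reflexivity.
  assert (Fix : forall a x, act a x = x -> f a = gone).
  { intros a x Q. apply (f_equal (fun z => z (exist _ f Hf))) in Q. unfold act in Q. simpl in Q.
    apply (gcancel_r (x (exist _ f Hf))). now rewrite Q, gone_l. }
  destruct (orbit_rep K act HK A1 AM) as [r [R1 R2]].
  (* If [a y] and [y] were in one [K]-orbit, some [k a] with [k] in [K] would fix [y], so [f (k a)]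
     would be trivial. *)
  assert (Sep : forall e h a, In (e, h) w -> a = h \/ a = psi h -> ~ K a ->
    forall y, r (act a y) <> r y).
  { destruct HK as [K1 [KM KV]]. intros e h a Hin Ea Na y Q.
    destruct (R1 (act a y)) as [k [Hk Ek]], (R1 y) as [l [Hl El]].
    rewrite Ek, El, <- AM in Q.
    assert (Hlk : K (gmul (ginv l) k)) by auto.
    apply (Sf (gmul (gmul (ginv l) k) a)).
    - right. apply in_flat_map. exists (gmul (ginv l) k). split; auto.
      apply in_flat_map. exists (e, h). split; auto. simpl. destruct Ea as [->| ->]; auto.
    - intros Q'. apply Na. replace a with (ginv (gmul (ginv l) k)); auto.
      symmetry. now apply ginv_unique.
    - apply (Fix _ y). rewrite <- gassoc, AM, Q, <- AM, ginv_l. apply A1. }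
  set (N := length w). set (J := {j : nat | j <= N}).
  set (p := fun j => exist _ (min j N) (Nat.le_min_r j N) : J).
  set (x0 := (fun _ => gone) : X).
  assert (Pinj : forall a b, a <= N -> b <= N -> p a = p b -> a = b).
  { intros a b La Lb Q. apply (f_equal (fun z : J => proj1_sig z)) in Q. simpl in Q. lia. }
  destruct (conflict_free_walk p N (colors act tau r x0 w) Pinj) as [sigma [_ Wk]].
  { rewrite length_colors. apply Nat.le_refl. }
  { now apply (colors_conflict_free K phi psi). }
  destruct (HNN_skew act tau (fun x => sigma (r x)) HNN A1 AM) as [Phi [Ph [Pi [Pt Pv]]]].
  { auto. }
  { intros k x Hk. now rewrite R2. }
  exists (Sym (X * J)), Phi. split; [|split; [exact Ph|]].
  - apply finite_Sym, finite_prod.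
    + apply finite_fun; [|exact FF]. now apply (finite_homs S).
    + apply (finite_inj (fun j : J => proj1_sig j) (seq 0 (1 + N))).
      * intros [a La] [b Lb] Q. now apply subset_eq_compat.
      * intros [a La]. apply in_seq. simpl. lia.
  (* If [g] acts trivially, [p 0 = p N] forces [w] to be empty. Then [g = i h0] with [h0]
     nontrivial, and [f] detects [h0]. *)
  - intros Q.
    assert (Tr : pfun (Phi (wval i t w)) (x0, p 0) = (track act tau x0 w, p (length w))).
    { now apply wval_walk with (act := act) (tau := tau) (r := r) (sigma := sigma). }
    assert (Tg : pfun (Phi g) (x0, p 0) = (act h0 (track act tau x0 w), p (length w))).
    { rewrite Eg, Ph. simpl. now rewrite Tr, Pi. }
    rewrite Q in Tg.
    assert (Q1 : x0 = act h0 (track act tau x0 w)) by exact (f_equal fst Tg).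
    assert (Q2 : p 0 = p N) by exact (f_equal snd Tg).
    apply Pinj in Q2; try lia.
    assert (Ew : w = []) by now apply length_zero_iff_nil.
    rewrite Ew in Q1, Eg. simpl in Q1, Eg.
    apply (Sf h0); [now left| |].
    + intros ->. apply Ng. rewrite Eg, gone_r. apply hom_one. now destruct HNN.
    + apply (Fix h0 x0). now symmetry.
Qed.

Theorem theoremB (H : Group) (phi : H -> H) (K : H -> Prop)
    (G : Group) (i : H -> G) (t : G) :
  is_aut phi ->
  is_subgroup K -> proper_subset K ->
  proper_in_normalizer K ->
  is_HNN K phi i t ->
  hyperbolic G -> ~ residually_finite G ->
  finite_subset K /\ hyperbolic H /\ ~ residually_finite H.
Proof.
  intros Ha HK _ HN HNN HG NRF.
  assert (FK : finite_subset K).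
  { destruct (HNN_centralizer HNN Ha HK HN) as [c [C1 C2]].
    exact (hyperbolic_centralizer_finite K i c HG C1 C2). }
  assert (HH : hyperbolic H) by exact (HNN_base_hyperbolic HNN Ha HK FK HG).
  split; [exact FK|]. split; [exact HH|]. intros RF. apply NRF.
  destruct HH as [S [delta [Gen _]]].
  exact (HNN_residually_finite S HNN Ha HK FK Gen RF).
Qed.
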